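(* Let $Q_z$ be the linear operator on $\mathbb{C}[x_1,\ldots,x_n]^{S_n}$ defined by $Q_z\bar s_\lambda=q_\lambda(z)\bar s_\lambda$, $q_\lambda(z)=\bar s_\lambda(z,1,\ldots,1)$, and let $\mathcal S_n=\rho_0Q_{z_1}\cdots Q_{z_n}$ be the corresponding separating operator, which satisfies $\mathcal S_n:\bar s_\lambda\mapsto\prod_{j=1}^nq_\lambda(z_j)$ for every partition $\lambda$ of length $n$. Then for each $k=1,\ldots,n$ there exists a uniquely defined linear operator $$\mathcal A_k:\mathbb{C}[x_1,\ldots,x_k]^{S_k}\to\mathbb{C}[x_1,\ldots,x_{k-1}]^{S_{k-1}}\otimes\mathbb{C}[z_k]$$ satisfying $\rho_{k-1}Q_{z_k}=\mathcal A_k\rho_k$ on $\mathbb{C}[x_1,\ldots,x_n]^{S_n}$. Moreover, for real $z_k>1$ and real $1<\tilde y_1<\cdots<\tilde y_{k-1}$, the value of $[\mathcal A_kf](\tilde y)$ for $f\in\mathbb{C}[x_1,\ldots,x_k]^{S_k}$ is given by the integral $$[\mathcal A_kf](\tilde y)=\frac{(-1)^{k-1}(n-1)!}{(n-k)!\,(z_k-1)^{n-1}\,\Delta_{k-1}(\tilde y)\prod_{j=1}^{k-1}(\tilde y_j-1)^{n-k+1}}\int_{\tilde\Omega_x}d\tilde x\;\delta(\tilde x_1\cdots\tilde x_k-z_k\tilde y_1\cdots\tilde y_{k-1})\,\Delta_k(\tilde x)\prod_{j=1}^k(\tilde x_j-1)^{n-k}\,f(\tilde x),$$ where $\tilde x=(\tilde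 x_1,\ldots,\tilde x_k)$, $\tilde y=(\tilde y_1,\ldots,\tilde y_{k-1})$, and the integration domain is $$\tilde\Omega_x:\quad 1<\tilde x_1<\tilde y_1<\cdots<\tilde y_{k-1}<\tilde x_k.$$
   Context: Partitions of length $n$ are $\lambda=(\lambda_1,\ldots,\lambda_n)\in\mathbb{N}^n$ with $\lambda_1\ge\cdots\ge\lambda_n\ge0$. $\Delta_m(x)=\prod_{1\le i<j\le m}(x_i-x_j)$ (equal to $1$ for $m\le1$). The Schur function is $s_\lambda(x)=\det\{x_i^{\lambda_j+n-j}\}_{i,j=1}^n/\Delta_n(x)$, and $\bar s_\lambda(x)=s_\lambda(x)/s_\lambda(1,\ldots,1)$; the $\bar s_\lambda$ form a basis of the space $\mathbb{C}[x_1,\ldots,x_n]^{S_n}$ of symmetric polynomials. $Q_z$ maps $\mathbb{C}[x_1,\ldots,x_n]^{S_n}$ to $\mathbb{C}[x_1,\ldots,x_n]^{S_n}\otimes\mathbb{C}[z]$; in products each $Q_{z_j}$ acts on the $x$-variables, linearly over polynomials in the other $z$'s. For $k=0,\ldots,n$, $\rho_k$ is the specialization $(\rho_kf)(x_1,\ldots,x_k)=f(x_1,\ldots,x_k,1,\ldots,1)$ (leaving $z$-variables untouched); $\rho_0f=f(1,\ldots,1)$ and $\rho_n$ is the identity. $\delta$ is the Dirac delta function: for $c>0$, $\int_{\Omega}d\tilde x\,\delta(\tilde x_1\cdots\tilde x_k-c)\,g(\tilde x)$ denotes the integral of $g(\tilde x)/(\tilde x_1\cdots\tilde x_{k-1})$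 with $\tilde x_k=c/(\tilde x_1\cdots\tilde x_{k-1})$ substituted, over all $(\tilde x_1,\ldots,\tilde x_{k-1})$ such that the resulting point $\tilde x$ lies in $\Omega$ (for $k=1$ it is $g(c)$ if $c\in\Omega$). In the integral formula $[\mathcal A_kf](\tilde y)$ is the polynomial $\mathcal A_kf$ evaluated at $x_j=\tilde y_j$ ($j=1,\ldots,k-1$) and at the given $z_k$. *)

(* Defs.v *)
From HB Require Import structures.
From mathcomp Require Import all_boot all_order all_algebra all_fingroup.
From mathcomp Require Import all_classical all_reals all_analysis.
From mathcomp Require Import complex.
(* The notations of mpoly clash with those of the analysis library. *)
From mathcomp Require Import -(notations) mpoly.

Set Implicit Arguments.
Unset Strict Implicit.
Unset Printing Implicit Defensive.

Import Order.TTheory GRing.Theory Num.Theory.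
Local Open Scope ring_scope.

Notation "{ 'mpoly' T [ n ] }" := (mpoly n T)
  (at level 0, T, n at level 2, format "{ 'mpoly'  T [ n ] }").
Local Notation mX i := (mpolyX _ (mnm1 i)).

Section SymmetricPolynomials.
Variables (F : comNzRingType) (n : nat).

Record sympoly :=
  Sympoly { sympoly_val :> {mpoly F[n]}; _ : sympoly_val \is symmetric }.

HB.instance Definition _ := [isSub for sympoly_val].
HB.instance Definition _ := [Choice of sympoly by <:].
HB.instance Definition _ := [SubChoice_isSubComNzRing of sympoly by <:].
HB.instance Definition _ := [SubZmodule_isSubLmodule of sympoly by <:].
HB.instance Definition _ := [SubNzRing_SubLmodule_isSubLalgebra of sympoly by <:].
HB.instance Definition _ := [SubLalgebra_isSubAlgebra of sympoly by <:].

End SymmetricPolynomials.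

(* F-linear operators F[x_1..x_m]^{S_m} -> F[x_1..x_k]^{S_k} (x) F[z], the
   tensor product being {poly (sympoly F k)} with 'X as the variable z.  The
   scaling says that c in F acts on the target as the constant c%:A. *)
Notation zoperator F m k :=
  {linear sympoly F m -> {poly (sympoly F k)} | in_alg (sympoly F k) \; *:%R}.

Section Specialization.
Variables (F : comNzRingType) (n : nat).

(* The point (x_1, .., x_k, 1, .., 1) with n coordinates. *)
Definition rho_point (k : nat) : n.-tuple {mpoly F[k]} :=
  [tuple oapp (fun j : 'I_k => mX j) 1 (insub (val i)) | i < n].

Lemma rho_point_sym k (s : 'S_k) : (k <= n)%N ->
  perm_eq (rho_point k) [tuple msym s (rho_point k)`_i | i < n].
Proof.
move=> lekn.
have msymXE (j : 'I_k) : msym s (mX j) = mX (s j) :> {mpoly F[k]}.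
  by rewrite /msym mmapX mmap1U.
have rhoE : rho_point k = [seq mX j | j : 'I_k] ++ nseq (n - k) 1 :> seq _.
  apply: (@eq_from_nth _ 0) => [|i].
    by rewrite size_tuple size_cat size_map size_enum_ord size_nseq subnKC.
  rewrite size_tuple => lt_in.
  have -> : (rho_point k)`_i = tnth (rho_point k) (Ordinal lt_in).
    by rewrite (tnth_nth 0).
  rewrite tnth_mktuple nth_cat size_map size_enum_ord /=.
  case: insubP => [j lt_ik val_j|].
    rewrite -val_j ltn_ord (nth_map j) ?size_enum_ord ?ltn_ord //=.
    by rewrite nth_ord_enum.
  rewrite -leqNgt => le_ki.
  by rewrite ltnNge le_ki /= nth_nseq ltn_sub2r // (leq_ltn_trans le_ki).
have -> : [tuple msym s (rho_point k)`_i | i < n]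
    = [seq msym s p | p <- rho_point k] :> seq _.
  apply: (@eq_from_nth _ 0) => [|i].
    by rewrite size_map !size_tuple.
  rewrite size_tuple => lt_in.
  rewrite (nth_map 0) ?size_tuple //.
  by rewrite -(tnth_nth 0 _ (Ordinal lt_in)) tnth_mktuple.
rewrite rhoE map_cat map_nseq msym1 perm_cat2r -map_comp.
rewrite (eq_map (g := (fun j => mX j) \o s)); last by move=> j /=.
rewrite map_comp perm_map // uniq_perm ?enum_uniq //.
  by rewrite map_inj_uniq ?enum_uniq //; apply: perm_inj.
move=> j; rewrite mem_enum; apply/esym/mapP.
by exists ((s^-1)%g j); rewrite ?mem_enum ?permKV.
Qed.

Lemma rho_sym k (f : sympoly F n) : (k <= n)%N ->
  comp_mpoly (rho_point k) f \is symmetric.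
Proof.
by move=> lekn; apply: msym_comp_poly (valP f) _ => s; apply: rho_point_sym.
Qed.

(* The default value 0 is reached only when n < k, by rho_sym. *)
Definition rho (k : nat) (f : sympoly F n) : sympoly F k :=
  insubd 0 (comp_mpoly (rho_point k) f).

Lemma val_rho k f : (k <= n)%N -> val (rho k f) = comp_mpoly (rho_point k) f.
Proof. by move=> lekn; rewrite val_insubd rho_sym. Qed.

End Specialization.

(* Delta_m(x_1, .., x_m) *)
Definition Delta (A : comNzRingType) (m : nat) (x : 'I_m -> A) : A :=
  \prod_(i < m) \prod_(j < m | (i < j)%N) (x i - x j).

Lemma newton_interpolation (A : comNzRingType) (x : nat -> A) (f : {poly A}) N :
  exists (c : nat -> A) (g : {poly A}),
    f = \sum_(k < N) c k *: \prod_(l < k) ('X - (x l)%:P)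
        + g * \prod_(l < N) ('X - (x l)%:P).
Proof.
elim: N => [|N [c [g ->]]].
  by exists (fun=> 0), f; rewrite !big_ord0 add0r mulr1.
have /factor_theorem[h hE] : root (g - g.[x N]%:P) (x N).
  by rewrite rootE hornerD hornerN hornerC subrr.
exists (fun k => if k == N then g.[x N] else c k), h.
rewrite [in RHS]big_ord_recr /= eqxx -addrA; congr (_ + _).
  by apply: eq_bigr => k _; rewrite ltn_eqF.
rewrite [in RHS]big_ord_recr /= (mulrC (\prod_(_ < _) _)) mulrA -hE.
by rewrite -mul_polyC -mulrDl subrKC.
Qed.

Lemma Delta_dvd_det (A : comNzRingType) n (x : 'I_n -> A) (f : 'I_n -> {poly A}) :
  exists d, \det (\matrix_(i, j) (f j).[x i]) = d * Delta x.
Proof.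
pose xn m := oapp x 0 (insub m).
have xnE (i : 'I_n) : xn i = x i by rewrite /xn valK.
have /choice[c cE] j : exists c : nat -> A,
    forall i : 'I_n, (f j).[x i] = \sum_(k < n) \prod_(l < k) (x i - xn l) * c k.
  have [c [g fE]] := newton_interpolation xn (f j) n.
  have w0 (i : 'I_n) : (\prod_(l < n) ('X - (xn l)%:P)).[x i] = 0.
    by rewrite horner_prod (bigD1 i) //= hornerXsubC xnE subrr mul0r.
  exists c => i; rewrite fE hornerD hornerM w0 mulr0 addr0.
  rewrite horner_sum; apply: eq_bigr => k _.
  rewrite hornerZ mulrC horner_prod; congr (_ * _).
  by apply: eq_bigr => l _; rewrite hornerXsubC.
pose L := \matrix_(i < n, k < n) \prod_(l < k) (x i - xn l).
have -> : \matrix_(i, j) (f j).[x i] = L *m \matrix_(k, j) c j k.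
  apply/matrixP => i j; rewrite !mxE cE.
  by apply: eq_bigr => k _; rewrite !mxE.
rewrite det_mulmx det_trig; last first.
  apply/is_trig_mxP => i k lt_ik; rewrite mxE (bigD1 (Ordinal lt_ik)) //=.
  by rewrite xnE subrr mul0r.
suff [e ->] : exists e, \prod_(i < n) L i i = e * Delta x.
  by exists (e * \det (\matrix_(k, j) c j k)); rewrite mulrAC.
exists (\prod_(i < n) \prod_(j < n | (i < j)%N) -1); rewrite -big_split /=.
under [RHS]eq_bigr do rewrite -big_split /=.
rewrite [RHS](exchange_big_dep xpredT) //=; apply: eq_bigr => i _.
rewrite mxE [LHS](big_ord_widen_cond n xpredT (fun l => x i - xn l)) ?(ltnW (ltn_ord i)) //.
by apply: eq_bigr => j _; rewrite xnE mulN1r opprB.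
Qed.

Section Schur.
Variables (F : fieldType) (n : nat).
Implicit Type lam : n.-tuple nat.

Definition is_partition lam : bool := sorted geq lam.

(* Indices are 0-based: column j carries the exponent lambda_j + (n - 1 - j). *)
Definition alternant lam : {mpoly F[n]} :=
  \det (\matrix_(i < n, j < n) mX i ^+ (tnth lam j + (n - j.+1))).

(* The quotient alternant lam / Delta_n(x), unique since {mpoly F[n]} is an
   integral domain; it exists by schurE below, so the default 0 is not used. *)
Definition schur lam : sympoly F n :=
  xget 0 [set s : sympoly F n |
    val s * Delta (fun i : 'I_n => mX i) = alternant lam].

Lemma Delta_X_neq0 : Delta (fun i : 'I_n => mX i : {mpoly F[n]}) != 0.
Proof.
apply/prodf_neq0 => i _; apply/prodf_neq0 => j lt_ij.
rewrite subr_eq0; apply: contraTneq lt_ij => /(congr1 (mcoeff (mnm1 i))).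
rewrite !mcoeffX eqxx => /eqP; case: (mnm1 j =P mnm1 i) => [/mnmP/(_ j)|_].
  by rewrite !mnm1E eqxx; case: eqP => // ->; rewrite ltnn.
by rewrite oner_eq0.
Qed.

Lemma msym_det (e : 'I_n -> nat) (s : 'S_n) :
  let D : {mpoly F[n]} := \det (\matrix_(i < n, j < n) mX i ^+ e j) in
  msym s D = (-1) ^+ s * D.
Proof.
rewrite /= -det_perm -det_mulmx -det_map_mx; congr (\det _).
rewrite -row_permE; apply/matrixP => i j; rewrite !mxE rmorphXn /=.
by rewrite /msym mmapX mmap1U.
Qed.

Lemma msym_Delta (s : 'S_n) :
  let D : {mpoly F[n]} := Delta (fun i : 'I_n => mX i) in
  msym s D = (-1) ^+ s * D.
Proof.
have [u DE] : exists u : {mpoly F[n]}, u \is symmetric /\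
    Delta (fun i : 'I_n => mX i) =
    u * \det (\matrix_(i < n, j < n) mX i ^+ j).
  exists (\prod_(i < n) \prod_(j < n | (i < j)%N) -1); split.
    by do 2!apply: rpred_prod => ? _; rewrite rpredN rpred1.
  pose a : 'rV[{mpoly F[n]}]_n := \row_i mX i.
  have -> : \matrix_(i < n, j < n) mX i ^+ j = (Vandermonde n a)^T.
    by apply/matrixP => i j; rewrite !mxE.
  rewrite det_tr det_Vandermonde -big_split; apply: eq_bigr => i _.
  rewrite -big_split; apply: eq_bigr => j _.
  by rewrite /= !mxE mulN1r opprB.
case: DE => /issymP/(_ s) symu /= ->.
by rewrite msymM symu (msym_det (fun j => j)) mulrCA.
Qed.

Lemma schurE lam :
  val (schur lam) * Delta (fun i : 'I_n => mX i) = alternant lam.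
Proof.
have [d dE] := Delta_dvd_det (fun i : 'I_n => mX i : {mpoly F[n]})
  (fun j => 'X ^+ (tnth lam j + (n - j.+1))).
have {}dE : alternant lam = d * Delta (fun i : 'I_n => mX i).
  by rewrite -dE; congr (\det _); apply/matrixP => i j; rewrite !mxE hornerXn.
have symd : d \is symmetric.
  apply/issymP => s.
  have := msym_det (fun j => tnth lam j + (n - j.+1))%N s.
  rewrite /= -/(alternant lam) dE msymM msym_Delta mulrCA.
  by move=> /(mulrI (unitrX _ (unitrN1 _)))/(mulIf Delta_X_neq0).
apply: (@xgetPex _ _ [set s : sympoly F n |
  val s * Delta (fun i : 'I_n => mX i) = alternant lam]).
by exists (Sympoly symd); rewrite /= dE.
Qed.

Definition nschur lam : sympoly F n :=
  (meval (fun=> 1) (val (schur lam)))^-1 *: schur lam.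

(* q_lambda(z) = nschur lam (z, 1, .., 1), with z = 'X *)
Definition q_lambda lam : {poly F} :=
  mmap polyC (fun i : 'I_n => if val i == 0%N then 'X else 1)
    (val (nschur lam)).

Definition is_Qz (Q : zoperator F n n) : Prop :=
  forall lam, is_partition lam ->
    Q (nschur lam) = nschur lam *: map_poly (in_alg (sympoly F n)) (q_lambda lam).

End Schur.

Section Separating.
Variables (F : fieldType) (n : nat).

(* p(z) |-> p(z_j), from A[z] to A[z_1, .., z_n] *)
Definition zsubst (A : comNzRingType) (j : 'I_n) (p : {poly A}) : {mpoly A[n]} :=
  (map_poly (@mpolyC n A) p).[mX j].

(* The action of Q_{z_j} on F[x]^{S_n} (x) F[z_1, .., z_n], where it is extended
   linearly over polynomials in z: sum_m f_m z^m |-> sum_m Q_{z_j}(f_m) z^m. *)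
Definition Qz_ext (Q : zoperator F n n) (j : 'I_n)
    (g : {mpoly (sympoly F n)[n]}) : {mpoly (sympoly F n)[n]} :=
  \sum_(m <- msupp g) zsubst j (Q (mcoeff m g)) * mpolyX _ m.

(* rho_0 Q_{z_1} .. Q_{z_n}, with F[x_1..x_0]^{S_0} = F as coefficients *)
Definition separating (Q : zoperator F n n) (f : sympoly F n) :
    {mpoly (sympoly F 0)[n]} :=
  map_mpoly (rho 0) (foldr (Qz_ext Q) (mpolyC n f) (enum 'I_n)).

End Separating.

Section Integral.
Variable R : realType.
Local Notation C := R[i].

(* The Lebesgue integral over R^m, as an iterated integral; points are sequences
   of length m. *)
Fixpoint Rn_integral (m : nat) (h : seq R -> R) : R :=
  if m is m'.+1 then
    \int[@lebesgue_measure R]_t Rn_integral m' (fun s => h (t :: s))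
  else h [::].

(* int_Omega dx delta(x_1 .. x_k - c) g(x), for 0 < k and 0 < c *)
Definition delta_integral (k : nat) (c : R) (Omega : pred (seq R))
    (g : seq R -> C) : C :=
  let h (s : seq R) : C :=
    let p := \prod_(t <- s) t in
    let x := rcons s (c / p) in
    if Omega x then g x / p%:C%C else 0 in
  Complex (Rn_integral k.-1 (fun s => complex.Re (h s)))
          (Rn_integral k.-1 (fun s => complex.Im (h s))).

(* 1 < x_1 < y_1 < x_2 < .. < y_{k-1} < x_k *)
Definition interlacing (k : nat) (y x : seq R) : bool :=
  (1 < x`_0) && [forall j : 'I_k.-1, x`_j < y`_j < x`_j.+1].

Definition sym_eval (k : nat) (x : seq R) (f : sympoly C k) : C :=
  meval (fun i : 'I_k => (x`_i)%:C%C) (val f).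

Definition symz_eval (k : nat) (x : seq R) (z : R) (p : {poly (sympoly C k)}) : C :=
  (map_poly (sym_eval x) p).[z%:C%C].

End Integral.

(* Main.v *)
Require Import Defs.
From HB Require Import structures.
From mathcomp Require Import all_boot all_order all_algebra all_fingroup.
From mathcomp Require Import all_classical all_reals all_analysis.
From mathcomp Require Import complex.
From mathcomp Require Import -(notations) mpoly.
From mathcomp Require Import ring lra zify.

Set Implicit Arguments.
Unset Strict Implicit.
Unset Printing Implicit Defensive.

Import Order.TTheory GRing.Theory Num.Theory.
Local Open Scope ring_scope.

(* Write l_j = lambda_j + n - j.  By Newton interpolation at the points x_1, .., x_k
   and 1 (with multiplicity n - k), the determinant D_k(x) with rows x_i^{l_j} for i <= k
   and binomials C(l_j, n - i) for i > k equals
   Delta_k(x) prod_i (x_i - 1)^{n-k} s_lambda(x_1, .., x_k, 1, .., 1), so the integral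
   formula on normalized Schur functions amounts to
     int D_k = (-1)^{k-1} (n-k)!/(n-1)! D_{k-1}(y) D_1(z) / D_0.
   Each integration over an interval [a, b] acts on the truncated residue sums
   K_P(c) = [c > 1] sum_{p in P} c^p / prod_{q <> p} (p - q)  by
     int_a^b t^{p-1} K_P(c/t) dt = a^p K_{p,P}(c/a) - b^p K_{p,P}(c/b),
   so the integral of a monomial over the interlacing domain is a signed sum over the
   choices, for each i < k, of an endpoint u_i of the interval (y_{i-1}, y_i), y_0 = 1.
   After antisymmetrization a choice repeating an endpoint gives a determinant with two
   equal rows; only u = (1, y_1, .., y_{k-1}) survives, and row operations turn its
   determinant into D_{k-1}(y).  The case k = 1 evaluates the remaining factor.
   Since the s_lambda span, rho_{k-1} Q_z f is thereby determined by rho_k f; as rho_k is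
   onto (the e_i(x_1 - 1, .., x_n - 1) specialize to e_i(x_1 - 1, .., x_k - 1)), this
   yields A_k, its uniqueness and the formula. *)

Lemma card_ord_geq n k : (k <= n)%N -> #|[pred j : 'I_n | (k <= j)%N]| = (n - k)%N.
Proof.
move=> le_kn; apply: (@addnI k); rewrite subnKC // -[RHS](card_ord n).
rewrite -(cardC [pred j : 'I_n | (j < k)%N]); congr (_ + _)%N.
  by rewrite -sum1_card -(big_ord_widen n (fun=> 1%N)) // sum1_card card_ord.
by apply: eq_card => j; rewrite !inE -leqNgt.
Qed.

(** * Newton interpolation and confluent alternants *)

Section NewtonCoefficients.
Variable A : comNzRingType.
Implicit Types x y : nat -> A.

(** This is the complete homogeneous polynomial of degree [l - r] in [x 0, .., x r], that is, the
    divided difference of [X^l] at these points. The recursion makes sense at coinciding points. *)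
Fixpoint newton_coef x (l r : nat) : A :=
  if l is l'.+1 then
    (if r is r'.+1 then newton_coef x l' r' else 0) + x r * newton_coef x l' r
  else (r == 0%N)%:R.

Lemma newton_coef_gt x l r : (l < r)%N -> newton_coef x l r = 0.
Proof.
elim: l r => [|l IHl] [|r] //= lt_lr.
by rewrite IHl // IHl ?mulr0 ?addr0 // ltnW.
Qed.

Lemma eq_newton_coef x y l r :
  (forall i, (i <= r)%N -> x i = y i) -> newton_coef x l r = newton_coef y l r.
Proof.
elim: l r => [|l IHl] [|r] //= eqxy; rewrite eqxy //.
  by rewrite (IHl 0%N).
by rewrite (IHl r) ?(IHl r.+1) // => i le_ir; apply: eqxy; lia.
Qed.

Lemma newton_coef1 l r : newton_coef (fun=> 1) l r = 'C(l, r)%:R.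
Proof.
elim: l r => [|l IHl] [|r] //=.
  by rewrite IHl !bin0 mul1r add0r.
by rewrite !IHl mul1r binS natrD addrC.
Qed.

Lemma expr_newton x a l N : (l < N)%N ->
  a ^+ l = \sum_(r < N) newton_coef x l r * \prod_(j < r) (a - x j).
Proof.
elim: l N => [|l IHl] [|N] // lt_lN.
  rewrite big_ord_recl /= big_ord0 mulr1 big1 ?addr0 // => i _.
  by rewrite /= mul0r.
rewrite exprSr (IHl N.+1 (ltnW lt_lN)) mulr_suml.
have -> : \sum_(r < N.+1) newton_coef x l.+1 r * \prod_(j < r) (a - x j) =
  \sum_(r < N) newton_coef x l r * \prod_(j < r.+1) (a - x j) +
  \sum_(r < N.+1) x r * newton_coef x l r * \prod_(j < r) (a - x j).
  rewrite [LHS]big_ord_recl [X in _ = _ + X]big_ord_recl /= add0r.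
  rewrite addrCA -big_split /=; congr (_ + _).
  by apply: eq_bigr => r _; rewrite -mulrDl.
have -> : \sum_(r < N) newton_coef x l r * \prod_(j < r.+1) (a - x j) =
  \sum_(r < N.+1) newton_coef x l r * \prod_(j < r.+1) (a - x j).
  by rewrite [RHS]big_ord_recr /= newton_coef_gt // mul0r addr0.
rewrite -big_split /=; apply: eq_bigr => r _.
by rewrite big_ord_recr /=; ring.
Qed.

(** At the node [x m] every basis product with [r > m] vanishes, so [N] terms suffice whatever the
    exponent [l]. *)
Lemma expr_newton_root x l N m : (m < N)%N ->
  x m ^+ l = \sum_(r < N) newton_coef x l r * \prod_(j < r) (x m - x j).
Proof.
move=> lt_mN; rewrite (@expr_newton x _ _ (l.+1 + N)); last by lia.
rewrite [RHS](big_ord_widen (l.+1 + N)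
  (fun r => newton_coef x l r * \prod_(j < r) (x m - x j))) ?leq_addl //.
rewrite [LHS](bigID (fun r : 'I__ => (r < N)%N)) /= [X in _ + X]big1 ?addr0 // => r.
rewrite -leqNgt => le_Nr.
by rewrite (bigD1 (Ordinal (leq_trans lt_mN le_Nr))) //= subrr mul0r mulr0.
Qed.

(* The rows [i < k] of [pow_newton_mx k] hold the powers of the points, the others
   the Newton coefficients at the points taken in reverse order. *)
Definition pow_newton_mx n k x (l : 'I_n -> nat) : 'M[A]_n :=
  \matrix_(i, j) if (i < k)%N then x i ^+ l j
                 else newton_coef (fun r => x (n.-1 - r)%N) (l j) (n.-1 - i).

(** Since the nodes are taken from the last one down, the Newton expansion of a power of [x i]
    involves only the rows [m >= i]. The transition matrix [L] is therefore upper triangular, and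
    its diagonal gives the product of differences. *)
Lemma det_pow_newton_mx n k x (l : 'I_n -> nat) :
  \det (pow_newton_mx k x l) =
  (\prod_(i < n | (i < k)%N) \prod_(j < n | (i < j)%N) (x i - x j)) *
  \det (pow_newton_mx 0 x l).
Proof.
pose L : 'M[A]_n := \matrix_(i, m) if (i < k)%N
  then \prod_(j < n | (m < j)%N) (x i - x j) else (i == m)%:R.
have -> : pow_newton_mx k x l = L *m pow_newton_mx 0 x l.
  apply/matrixP => i j; rewrite !mxE.
  case: ifP => lt_ik; last first.
    rewrite (bigD1 i) //= !mxE lt_ik eqxx mul1r big1 ?addr0 // => m ne_mi.
    by rewrite !mxE lt_ik eq_sym (negbTE ne_mi) mul0r.
  have := @expr_newton_root (fun r => x (n.-1 - r)%N) (l j) n (n.-1 - i).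
  have ltin := ltn_ord i.
  have -> : (n.-1 - (n.-1 - i) = i)%N by lia.
  move=> -> //; last by lia.
  rewrite (reindex_inj rev_ord_inj) /=; apply: eq_bigr => m _.
  rewrite !mxE lt_ik /= mulrC; congr (_ * _); last by congr newton_coef; lia.
  have := ltn_ord m => ltmn.
  rewrite (big_ord_widen n (fun r => x i - x (n.-1 - r)%N)); last by lia.
  rewrite (reindex_inj rev_ord_inj) /=; apply: eq_big => [r|r _] /=.
    by have := ltn_ord r; lia.
  by congr (_ - x _); have := ltn_ord r; lia.
rewrite det_mulmx -det_tr det_trig; last first.
  apply/is_trig_mxP => i j lt_ij; rewrite !mxE; case: ifP => _.
    by rewrite (bigD1 j) //= subrr mul0r.
  by case: eqP => // eji; rewrite eji ltnn in lt_ij.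
congr (_ * _); rewrite [RHS]big_mkcond /=; apply: eq_bigr => i _.
by rewrite !mxE eqxx.
Qed.

(** The form taken by the alternant when the points of index at least [k] merge at 1: the binomials
    are the divided derivatives of the monomials at 1. *)
Definition confluent_mx n k x (l : 'I_n -> nat) : 'M[A]_n :=
  \matrix_(i, j) if (i < k)%N then x i ^+ l j else 'C(l j, n.-1 - i)%:R.

(** Below row [k] all Newton nodes equal 1, which yields the binomials. Each point [x i] with
    [i < k] then meets the [n - k] nodes equal to 1, whence the powers of [x i - 1]. The last factor
    is the value of a Schur function, by [meval_schur]. *)
Lemma det_confluent_mx n k x (l : 'I_n -> nat) : (k <= n)%N ->
  \det (confluent_mx k x l) =
  Delta (fun i : 'I_k => x i) * \prod_(i < k) (x i - 1) ^+ (n - k) *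
  \det (pow_newton_mx 0 (fun i => if (i < k)%N then x i else 1) l).
Proof.
move=> le_kn; set x' := (fun i => if _ then _ else _).
have -> : confluent_mx k x l = pow_newton_mx k x' l.
  apply/matrixP => i j; rewrite !mxE /x'; case: ifP => // ltik.
  rewrite -newton_coef1; apply: eq_newton_coef => r le_r.
  by case: ifP => // ltk; have := ltn_ord i; lia.
rewrite det_pow_newton_mx; congr (_ * _).
rewrite /Delta -big_split /= (big_ord_widen n (fun i : nat =>
  \prod_(j < k | (i < j)%N) (x i - x j) * (x i - 1) ^+ (n - k))) //.
apply: eq_bigr => i lt_ik; rewrite (bigID (fun j : 'I_n => (j < k)%N)) /=.
congr (_ * _).
  rewrite (big_ord_widen_cond n (fun j => i < j)%N (fun j => x i - x j)) //.
  by apply: eq_bigr => j /andP[_ ltjk]; rewrite /x' lt_ik ltjk.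
transitivity (\prod_(j < n | (k <= j)%N) (x i - 1)).
  apply: eq_big => j; first by lia.
  by rewrite /x' lt_ik => /andP[_ /negbTE->].
by rewrite prodr_const; congr (_ ^+ _); apply: card_ord_geq.
Qed.

End NewtonCoefficients.

Lemma rmorph_newton_coef (A B : comNzRingType) (f : {rmorphism A -> B}) x l r :
  f (newton_coef x l r) = newton_coef (f \o x) l r.
Proof.
elim: l r => [|l IHl] [|r] //=; rewrite ?rmorph0 ?rmorph1 ?rmorphD ?rmorphM //.
  by rewrite IHl rmorph0.
by rewrite !IHl.
Qed.

Lemma rmorph_det_pow_newton (A B : comNzRingType) (f : {rmorphism A -> B})
    n k x (l : 'I_n -> nat) :
  f (\det (pow_newton_mx k x l)) = \det (pow_newton_mx k (f \o x) l).
Proof.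
rewrite -det_map_mx; congr (\det _); apply/matrixP => i j; rewrite !mxE.
by case: ifP => _; rewrite ?rmorphXn ?rmorph_newton_coef.
Qed.

Lemma rmorph_det_confluent (A B : comNzRingType) (f : {rmorphism A -> B})
    n k x (l : 'I_n -> nat) :
  f (\det (confluent_mx k x l)) = \det (confluent_mx k (f \o x) l).
Proof.
rewrite -det_map_mx; congr (\det _); apply/matrixP => i j; rewrite !mxE.
by case: ifP => _; rewrite ?rmorphXn ?rmorph_nat.
Qed.

(** * Residue sums and determinants *)

Section PartialFractions.
Variable F : numFieldType.
Implicit Types (P : seq nat) (c : F).

(* The residue sum of c^s / prod_(p in P) (s - p) over its poles s = p. *)
Definition residue_sum P c : F :=
  \sum_(p <- P) c ^+ p / \prod_(q <- P | q != p) (p%:R - q%:R).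

(** The factors [l j - l p] in the rows [i >= k] are those that complete the denominator of a
    residue over [k] exponents to the one over all exponents. *)
Definition weighted_mx n k (u : nat -> F) (l : 'I_n -> nat) (j : 'I_n) : 'M[F]_n :=
  \matrix_(i, p) if (i < k)%N then u i ^+ l p
                 else ((l j)%:R - (l p)%:R) * 'C(l p, n.-1 - i)%:R.

Lemma big_perm_enum_mkseq (T : Type) (idx : T) (op : Monoid.com_law idx) n k
    (g : 'I_n.+1 -> nat) (Pr : pred nat) (G : nat -> T) : (k <= n.+1)%N ->
  \big[op/idx]_(p <- mkseq (g \o inord) k | Pr p) G p =
  \big[op/idx]_(i < n.+1 | (i < k)%N && Pr (g i)) G (g i).
Proof.
move=> le_kn; rewrite big_map -[X in iota 0 X]subn0 -/(index_iota 0 k) big_mkord.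
rewrite (big_ord_widen_cond n.+1 (fun i => Pr (g (inord i)))
  (fun i => G (g (inord i)))) //.
apply: eq_big => [i|i _] /=; first by rewrite inord_val andbC.
by rewrite inord_val.
Qed.

(** The residue sum has its poles at [l (s i)] for [i < k]. Putting its terms over the full
    denominator creates the numerator [prod_(i >= k) (l j - l (s i))], which vanishes at the
    exponents that are not poles. The sum can thus run over all [j], with weights independent of
    [s], and the numerator is distributed over the rows of a determinant. *)
Lemma sum_det_residue n k (u : nat -> F) (l : 'I_n.+1 -> nat) c :
  injective l -> (k <= n.+1)%N ->
  \sum_(s : 'S_n.+1) (-1) ^+ s *
    (\prod_(i < n.+1) (confluent_mx k u l) i (s i)) *
    residue_sum (mkseq ((l \o s) \o inord) k) c =
  \sum_j c ^+ l j / (\prod_(q | q != j) ((l j)%:R - (l q)%:R)) *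
         \det (weighted_mx k u l j).
Proof.
move=> injl le_kn.
pose w j := c ^+ l j / (\prod_(q | q != j) ((l j)%:R - (l q)%:R)).
have resE (s : 'S_n.+1) : residue_sum (mkseq ((l \o s) \o inord) k) c =
    \sum_j w j * \prod_(i < n.+1 | (k <= i)%N) ((l j)%:R - (l (s i))%:R).
  rewrite [RHS](reindex_inj (@perm_inj _ s)) /=.
  rewrite [RHS](bigID (fun i : 'I__ => (i < k)%N)) /=.
  rewrite [X in _ = _ + X]big1 ?addr0; last first.
    move=> i; rewrite -leqNgt => le_ki.
    by rewrite (bigD1 i) //= subrr mul0r mulr0.
  rewrite /residue_sum (@big_perm_enum_mkseq _ _ _ n k (l \o s)) //.
  apply: eq_big => [i|i]; first by rewrite andbT.
  rewrite andbT => lt_ik; rewrite /w.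
  rewrite (@big_perm_enum_mkseq _ _ _ n k (l \o s)) //=.
  rewrite [X in _ = _ / X * _](reindex_inj (@perm_inj _ s)) /=.
  rewrite [X in _ = _ / X * _](bigID (fun i : 'I__ => (i < k)%N)) /=.
  rewrite invfM -!mulrA; congr (_ * _).
  have -> : \prod_(q < n.+1 | (s q != s i) && ~~ (q < k)%N)
      ((l (s i))%:R - (l (s q))%:R) =
      \prod_(q < n.+1 | (k <= q)%N) ((l (s i))%:R - (l (s q))%:R) :> F.
    apply: eq_bigl => q; rewrite -leqNgt (inj_eq perm_inj).
    by case: eqP => //= ->; rewrite leqNgt lt_ik.
  rewrite mulVf ?mulr1; last first.
    apply/prodf_neq0 => q le_kq; rewrite subr_eq0 eqr_nat (inj_eq injl).
    by rewrite (inj_eq perm_inj); apply: contraTneq le_kq => <-; rewrite -ltnNge.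
  congr (_^-1); apply: eq_bigl => q.
  by rewrite /= (inj_eq injl) (inj_eq perm_inj) andbC.
rewrite [RHS](eq_bigr (fun j => w j * \det (weighted_mx k u l j))) //.
clearbody w; under [LHS]eq_bigr do rewrite resE mulr_sumr.
rewrite exchange_big /=; apply: eq_bigr => j _.
rewrite mulr_sumr; apply: eq_bigr => s _.
rewrite -!mulrA [RHS]mulrCA; congr (_ * _); rewrite mulrCA; congr (_ * _).
rewrite [X in _ * X = _]big_mkcond -big_split /=; apply: eq_bigr => i _.
by rewrite !mxE (leqNgt k i); case: (ltnP i k) => _ /=; rewrite ?mulr1 // mulrC.
Qed.

Lemma det_weighted_mx_dup n k (u : nat -> F) (l : 'I_n -> nat) j (a b : 'I_n) :
  a != b -> (a < k)%N -> (b < k)%N -> u a = u b ->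
  \det (weighted_mx k u l j) = 0.
Proof.
move=> neab ltak ltbk euab; apply: (determinant_alternate neab) => p.
by rewrite !mxE ltak ltbk euab.
Qed.

(** The row of powers of 1 is the binomial row of order 0, last in the confluent matrix; the other
    power rows are shifted by one. With [m = n - i], the weighted rows follow from [(l_j - l_p)
    C(l_p, m) = (l_j - m) C(l_p, m) - (m+1) C(l_p, m+1)]. The matrix [T] records these row
    operations. *)
Lemma det_weighted_mx1 n k (u : nat -> F) (l : 'I_n.+1 -> nat) j :
  (k <= n)%N -> u 0%N = 1 ->
  \det (weighted_mx k.+1 u l j) =
  (-1) ^+ k * (n - k)`!%:R * \det (confluent_mx k (u \o succn) l).
Proof.
move=> le_kn u0.
pose T : 'M[F]_n.+1 := \matrix_(i, r)
  if i == 0 then (r == ord_max)%:R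
  else if (i <= k)%N then (r.+1 == i)%:R
  else - (n - i).+1%:R * (r.+1 == i)%:R + ((l j)%:R - (n - i)%:R) * (r == i)%:R.
have -> : weighted_mx k.+1 u l j = T *m confluent_mx k (u \o succn) l.
  apply/matrixP => i p; rewrite !mxE ltnS.
  have sum_pred (G : 'I_n.+1 -> F) : (0 < i)%N ->
      \sum_(r < n.+1) (r.+1 == i)%:R * G r = G (inord i.-1).
    move=> i_gt0; rewrite (bigD1 (inord i.-1)) //= inordK ?prednK ?eqxx ?mul1r //.
      rewrite big1 ?addr0 // => r ne_r; case: eqP => [e|]; last by rewrite mul0r.
      by case/eqP: ne_r; apply/val_inj; rewrite -e /= inordK.
    exact: ltnW (ltn_ord i).
  have sum_diag (G : 'I_n.+1 -> F) : \sum_(r < n.+1) (r == i)%:R * G r = G i.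
    rewrite (bigD1 i) //= eqxx mul1r big1 ?addr0 // => r /negbTE->.
    by rewrite mul0r.
  case: (eqVneq i 0) => [->|i_neq0].
    rewrite /= u0 expr1n (bigD1 ord_max) //= !mxE !eqxx mul1r big1 ?addr0.
      by rewrite /= ltnNge le_kn /= subnn bin0.
    by move=> r /negbTE ner; rewrite !mxE /= ner mul0r.
  have i_gt0 : (0 < i)%N by rewrite lt0n.
  have ltin := ltn_ord i.
  under eq_bigr do rewrite !mxE (negbTE i_neq0).
  case: leqP => le_ik.
    rewrite sum_pred // inordK; last by lia.
    rewrite ifT /=; last by lia.
    by rewrite prednK.
  under eq_bigr do rewrite mulrDl -!mulrA.
  rewrite big_split /= -!mulr_sumr sum_pred // sum_diag inordK; last by lia.
  rewrite !ifF; try lia.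
  have -> : (n - i.-1 = (n - i).+1)%N by lia.
  set m := (n - i)%N; rewrite mulNr -natrM mul_bin_left natrM.
  (* The natural subtraction [l p - m] truncates when [l p < m], but then both binomials vanish. *)
  case: (leqP m (l p)) => [le_m|lt_m]; first by rewrite natrB //; ring.
  by rewrite bin_small // !mulr0 oppr0 addr0.
rewrite det_mulmx; congr (_ * _).
(* Row 0 of [T] has a single entry, in the last column. The cofactor sign [(-1)^n] and the sign
   [(-1)^(n-k)] of the triangular minor combine to [(-1)^k]. *)
rewrite (expand_det_row T 0) (bigD1 ord_max) //= big1 ?addr0; last first.
  by move=> r /negbTE ner; rewrite mxE eqxx ner mul0r.
rewrite mxE !eqxx mul1r /cofactor -det_tr det_trig; last first.
  apply/is_trig_mxP => a b lt_ab; rewrite !mxE -!val_eqE lift0 lift_max /=.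
  have lta : (a < n)%N := ltn_ord a.
  rewrite /bump leq0n (leqNgt n a) lta add0n add1n.
  rewrite eqSS (ltn_eqF lt_ab) (@ltn_eqF a b.+1) ?mulr0 ?addr0 ?if_same //.
  exact: ltnW.
have diagE (a : 'I_n) : ((row' 0 (col' ord_max T))^T) a a =
    if (k <= a)%N then - (n - a)%:R else 1.
  have lta : (a < n)%N := ltn_ord a.
  rewrite !mxE -!val_eqE lift0 lift_max /= /bump leq0n (leqNgt n a) lta.
  rewrite add0n add1n eqxx (ltn_eqF (ltnSn a)) mulr0 addr0.
  rewrite mulr1 (ltnNge a k).
  have -> : ((n - a.+1).+1 = n - a)%N by have := ltn_ord a; lia.
  by case: (k <= a)%N.
under eq_bigr do rewrite diagE.
rewrite -big_mkcond /= prodrN.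
have -> : #|[pred i : 'I_n | (k <= i)%N]| = (n - k)%N by exact: card_ord_geq.
rewrite mulrA -exprD add0n.
congr (_ * _).
  rewrite -signr_odd -[RHS]signr_odd; congr (_ ^+ _); rewrite oddD oddB //.
  by rewrite addbA addbb.
rewrite -natr_prod; congr (_%:R).
rewrite (reindex_inj rev_ord_inj) fact_prod big_add1 big_mkord /=.
rewrite (big_ord_widen n (fun i => i.+1)) ?leq_subr //.
apply: eq_big => [i|i _]; have ltin := ltn_ord i; last by rewrite /=; lia.
by rewrite unfold_in -[eqn _ _]/(k <= n - i.+1)%N; lia.
Qed.

End PartialFractions.

(** * Iterated integrals over the interlacing domain *)

Section IteratedIntegral.
Import numFieldNormedType.Exports.
Local Open Scope classical_set_scope.
Variable R : realType.
Local Notation mu := (@lebesgue_measure R).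
Implicit Types (f g F : R -> R) (a b c v w : R).

Definition has_integral f v :=
  mu.-integrable setT (EFin \o f) /\ \int[mu]_x f x = v.

Lemma has_integral0 : has_integral (fun=> 0) 0.
Proof.
split; first exact: integrable0.
by rewrite /Rintegral integral0.
Qed.

Lemma has_integralD f g v w : has_integral f v -> has_integral g w ->
  has_integral (fun t => f t + g t) (v + w).
Proof.
move=> [intf <-] [intg <-]; split; last by rewrite RintegralD.
by have -> : EFin \o (fun t => f t + g t) = (EFin \o f) \+ (EFin \o g)%E;
  [exact/funext | exact: integrableD].
Qed.

Lemma has_integralZ a f v :
  has_integral f v -> has_integral (fun t => a * f t) (a * v).
Proof.
move=> [intf <-]; split; last by rewrite RintegralZl.
exact: (@integrableZl _ _ _ mu setT measurableT a _ intf).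
Qed.

Lemma has_integral_sum (I : eqType) (r : seq I) (f : I -> R -> R) (v : I -> R) :
  {in r, forall i, has_integral (f i) (v i)} ->
  has_integral (fun t => \sum_(i <- r) f i t) (\sum_(i <- r) v i).
Proof.
elim: r => [|i r IHr] fv.
  rewrite big_nil; under eq_fun do rewrite big_nil; exact: has_integral0.
rewrite big_cons; under eq_fun do rewrite big_cons.
apply: has_integralD; first by apply: fv; rewrite mem_head.
by apply: IHr => j jr; apply: fv; rewrite inE jr orbT.
Qed.

Lemma has_integral_FTC f F a b : a < b ->
  (forall t, a <= t <= b -> is_derive t 1 F (f t)) ->
  (forall t, a <= t <= b -> {for t, continuous f}) ->
  has_integral (fun t => if a < t < b then f t else 0) (F b - F a).
Proof.
move=> lt_ab dF cf.
have cfab : {within `[a, b], continuous f}.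
  apply: continuous_in_subspaceT => t; rewrite inE /= in_itv /=; exact: cf.
have cF t : a <= t <= b -> {for t, continuous F}.
  move=> tab; apply/differentiable_continuous/derivable1_diffP.
  by have [] := dF t tab.
have intf : mu.-integrable `[a, b] (EFin \o f).
  by apply: continuous_compact_integrable => //; apply: segment_compact.
have intfo : mu.-integrable `]a, b[ (EFin \o f).
  by apply: integrableS intf => //; apply: subset_itv_oo_cc.
have -> : (fun t => if a < t < b then f t else 0) = f \_ `]a, b[.
  apply/funext => t; rewrite patchE.
  by rewrite mem_setE in_itv.
split.
  by rewrite -restrict_EFin; apply/(integrable_mkcond _ _).1.
rewrite -Rintegral_mkcond Rintegral_itv_bndo_bndc //.
rewrite Rintegral_itv_obnd_cbnd //; last first.
  by apply: integrableS intf => //; apply: subset_itv_oc_cc.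
rewrite /Rintegral (@continuous_FTC2 _ _ F) //.
split.
- move=> t; rewrite in_itv /= => /andP[lt_at lt_tb].
  by have [] := dF t; rewrite ?(ltW lt_at) ?(ltW lt_tb).
- by apply: cvg_at_right_filter; apply: cF; rewrite lexx ltW.
- by apply: cvg_at_left_filter; apply: cF; rewrite lexx ltW.
- move=> t; rewrite in_itv /= => /andP[lt_at lt_tb].
  have tab : a <= t <= b by rewrite !ltW.
  by rewrite derive1E (@derive_val _ _ _ _ _ _ _ (dF t tab)).
Qed.

(* Integrability is required at every stage of the iterated integral: this makes the
   predicate linear without any measurability in several variables. *)
Fixpoint has_Rn_integral (m : nat) (h : seq R -> R) v : Prop :=
  if m is m'.+1 then
    exists2 F, (forall t, has_Rn_integral m' (fun s => h (t :: s)) (F t)) &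
               has_integral F v
  else h [::] = v.

Lemma has_Rn_integralE m h v : has_Rn_integral m h v -> Rn_integral m h = v.
Proof.
elim: m h v => [|m IHm] h v //= [F hF [_ <-]].
by apply: eq_Rintegral => t _; apply: IHm.
Qed.

Lemma eq_has_Rn_integral m h1 h2 v :
  (forall s, size s = m -> h1 s = h2 s) ->
  has_Rn_integral m h1 v -> has_Rn_integral m h2 v.
Proof.
elim: m h1 h2 v => [|m IHm] h1 h2 v eq12 /=; first by rewrite eq12.
case=> F hF Fv; exists F => // t; apply: IHm (hF t) => s size_s.
by rewrite eq12 //= size_s.
Qed.

Lemma has_Rn_integral0 m : has_Rn_integral m (fun=> 0) 0.
Proof.
elim: m => [|m IHm] //=; exists (fun=> 0) => //; exact: has_integral0.
Qed.

Lemma has_Rn_integralD m h1 h2 v1 v2 :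
  has_Rn_integral m h1 v1 -> has_Rn_integral m h2 v2 ->
  has_Rn_integral m (fun s => h1 s + h2 s) (v1 + v2).
Proof.
elim: m h1 h2 v1 v2 => [|m IHm] h1 h2 v1 v2 /=; first by move=> -> ->.
move=> [F1 hF1 F1v] [F2 hF2 F2v]; exists (fun t => F1 t + F2 t).
  by move=> t; apply: IHm.
exact: has_integralD.
Qed.

Lemma has_Rn_integralZ m a h v :
  has_Rn_integral m h v -> has_Rn_integral m (fun s => a * h s) (a * v).
Proof.
elim: m h v => [|m IHm] h v /=; first by move=> ->.
move=> [F hF Fv]; exists (fun t => a * F t); first by move=> t; apply: IHm.
exact: has_integralZ.
Qed.

Lemma has_Rn_integral_sum m (I : Type) (r : seq I) (h : I -> seq R -> R) (v : I -> R) :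
  (forall i, has_Rn_integral m (h i) (v i)) ->
  has_Rn_integral m (fun s => \sum_(i <- r) h i s) (\sum_(i <- r) v i).
Proof.
move=> hv; elim: r => [|i r IHr].
  rewrite big_nil; under eq_fun do rewrite big_nil; exact: has_Rn_integral0.
by rewrite big_cons; under eq_fun do rewrite big_cons; apply: has_Rn_integralD.
Qed.

End IteratedIntegral.

(** * Integration of residue sums over one interval *)

Section ResidueSum.
Variable F : numFieldType.
Implicit Types (P : seq nat) (x : F).

(* The polynomial sum_p prod_(q <> p) (X - q) / (p - q) equals 1 at every p in P, so
   it is the constant 1, and its coefficient of degree [size P - 1] vanishes. *)
Lemma residue_sum1 P : uniq P -> (1 < size P)%N -> residue_sum P (1 : F) = 0.
Proof.
move=> uniqP P_gt1.
pose B p : {poly F} := \prod_(q <- P | q != p) ('X - q%:R%:P).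
pose w p : F := (\prod_(q <- P | q != p) (p%:R - q%:R))^-1.
have BE p : p \in P -> B p = \prod_(x <- [seq q%:R | q <- rem p P]) ('X - x%:P).
  by move=> pP; rewrite big_map rem_filter // big_filter.
have szB p : p \in P -> size (B p) = size P.
  move=> pP; rewrite BE // size_prod_XsubC size_map size_rem //.
  by rewrite prednK // ltnW.
have BX p : p \in P -> (B p)`_(size P).-1 = 1.
  move=> pP; rewrite -(szB p) // -lead_coefE.
  by apply/monicP; rewrite BE // monic_prod_XsubC.
pose L := \sum_(p <- P) w p *: B p.
have L1 : L - 1 = 0.
  apply: (@roots_geq_poly_eq0 _ _ [seq q%:R | q <- P]).
  - apply/allP => _ /mapP[p pP ->]; rewrite rootE !hornerE horner_sum.
    rewrite (bigD1_seq p) //= hornerZ horner_prod.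
    under [X in w p * X]eq_bigr do rewrite hornerXsubC.
    rewrite mulVf; last first.
      rewrite prodf_seq_neq0; apply/allP => q _; apply/implyP.
      by rewrite subr_eq0 eqr_nat eq_sym.
    rewrite big1_seq ?addr0 ?subrr // => q /andP[ne_qp qP].
    rewrite hornerZ horner_prod big_mkcond (bigD1_seq p) //= eq_sym ne_qp.
    by rewrite hornerXsubC subrr mul0r mulr0.
  - by rewrite map_inj_uniq // => i j /eqP; rewrite eqr_nat => /eqP.
  - rewrite size_map; apply: leq_trans (size_polyD _ _) _; rewrite geq_max.
    apply/andP; split; last by rewrite size_polyN size_poly1 ltnW.
    apply: leq_trans (size_sum _ _ _) _; apply/bigmax_leqP_seq => p pP _.
    by apply: leq_trans (size_scale_leq _ _) _; rewrite szB.
have /(congr1 (fun p : {poly F} => p`_(size P).-1)) : L = 1.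
  by apply/eqP; rewrite -subr_eq0 L1.
rewrite coef_sum coef1 -subn1 subn_eq0 leqNgt P_gt1 subn1 /= => E.
rewrite -[RHS]E.
apply: eq_big_seq => p pP; rewrite coefZ BX // expr1n mul1r mulr1; congr (_^-1).
Qed.

End ResidueSum.

Section StepIntegral.
Import numFieldNormedType.Exports.
Local Open Scope classical_set_scope.
Variable R : realType.
Implicit Types (P : seq nat) (a b c t : R).

(** The function is [c^q t^(p-q)], written so that a negative exponent [p - q] needs no separate
    treatment. *)
Lemma is_derive_monomial c t p q : 0 < t ->
  is_derive t 1 (fun t : R => t ^+ p * (c / t) ^+ q)
    ((p%:R - q%:R) * (t ^+ p * (c / t) ^+ q) / t).
Proof.
move=> t_gt0; have t_neq0 : t != 0 by rewrite gt_eqF.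
elim: p => [|p IHp].
  elim: q => [|q IHq].
    rewrite subrr !mul0r; under eq_fun do rewrite !expr0 mulr1.
    exact: is_derive_cst.
  have dV : is_derive t 1 (fun t : R => c / t) (- c / t ^+ 2).
    have dV0 := is_deriveV (f := id) t_neq0 (is_derive_id t 1).
    apply: (@is_derive_eq _ _ _ (fun t : R => c / t) _ _ _ _ (is_deriveZ c dV0)).
    by rewrite /GRing.scale /= mulr1 mulrN mulNr.
  have := is_deriveM dV IHq.
  rewrite (_ : _ * _ = fun t : R => t ^+ 0 * (c / t) ^+ q.+1); last first.
    by apply/funext => u; rewrite fctE /= [in RHS]exprS; rewrite !expr0 !mul1r.
  move/is_derive_eq; apply; rewrite /GRing.scale /= -[q.+1]addn1 natrD exprD expr1.
  by set X := (c / t) ^+ q; field.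
have := is_deriveM (is_derive_id t 1) IHp.
rewrite (_ : _ * _ = fun t : R => t ^+ p.+1 * (c / t) ^+ q); last first.
  by apply/funext => u; rewrite fctE /= exprS mulrA.
move/is_derive_eq; apply; rewrite /GRing.scale /= -[p.+1]addn1 natrD exprD expr1.
by set X := (c / t) ^+ q; field.
Qed.

Lemma is_derive_monomial_sum c t (r : seq nat) (w : nat -> R) p (e : nat -> nat) :
  0 < t ->
  is_derive t 1 (fun t : R => \sum_(q <- r) w q * (t ^+ p * (c / t) ^+ e q))
    (\sum_(q <- r) w q * ((p%:R - (e q)%:R) * (t ^+ p * (c / t) ^+ e q) / t)).
Proof.
move=> t_gt0; elim: r => [|q r IHr].
  rewrite big_nil; under eq_fun do rewrite big_nil; exact: is_derive_cst.
rewrite big_cons; under eq_fun do rewrite big_cons.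
exact: is_deriveD (is_deriveZ (w q) (is_derive_monomial c p (e q) t_gt0)) IHr.
Qed.

(** The cutoff encodes the unbounded last interval: once a single variable remains, fixed at [c] by
    the delta function, its constraint [y < c] reads [1 < c / y]. *)
Definition truncated_residue P c : R := if 1 < c then residue_sum P c else 0.

(* - t^p residue_sum (p :: P) (c / t) is an antiderivative: its term of exponent p is
   constant. *)
Lemma has_integral_residue_lt a b c p P : 0 < a -> a < b -> 0 < c -> p \notin P ->
  has_integral (fun t => if a < t < b then t ^+ p / t * residue_sum P (c / t) else 0)
    (a ^+ p * residue_sum (p :: P) (c / a) - b ^+ p * residue_sum (p :: P) (c / b)).
Proof.
move=> a_gt0 lt_ab c_gt0 pNP.
pose w q : R := (\prod_(r <- p :: P | r != q) (q%:R - r%:R))^-1.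
pose G t := - \sum_(q <- p :: P) w q * (t ^+ p * (c / t) ^+ q).
have GE t : G t = - (t ^+ p * residue_sum (p :: P) (c / t)).
  congr (- _); rewrite mulr_sumr; apply: eq_bigr => q _.
  by rewrite mulrC -mulrA.
have -> : a ^+ p * residue_sum (p :: P) (c / a) -
    b ^+ p * residue_sum (p :: P) (c / b) = G b - G a.
  by rewrite !GE opprK addrC.
pose v q : R := (\prod_(r <- P | r != q) (q%:R - r%:R))^-1.
(* Writing [1/t] as [(c/t)/c] turns the integrand into a sum of monomials already known to be
   derivable, hence continuous. *)
have fE t : t ^+ p / t * residue_sum P (c / t) =
    \sum_(q <- P) v q / c * (t ^+ p * (c / t) ^+ q.+1).
  rewrite mulr_sumr; apply: eq_bigr => q _.
  by rewrite -/(v q) exprS; set X := (c / t) ^+ q; set u := t^-1; field; rewrite gt_eqF.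
apply: has_integral_FTC => // t /andP[le_at _]; have t_gt0 := lt_le_trans a_gt0 le_at.
  have := is_deriveN (is_derive_monomial_sum c (p :: P) w p id t_gt0).
  move/is_derive_eq; apply.
  rewrite big_cons subrr !mul0r mulr0 add0r -sumrN mulr_sumr.
  apply: eq_big_seq => q qP; rewrite /w big_cons ifT; last first.
    by apply: contraNneq pNP => ->.
  rewrite invfM -/(v q); set X := (c / t) ^+ q.
  have ne_pq : p != q by apply: contraNneq pNP => ->.
  by field; rewrite gt_eqF //= subr_eq0 eqr_nat eq_sym ne_pq.
apply/differentiable_continuous/derivable1_diffP; under eq_fun do rewrite fE.
by have [] := is_derive_monomial_sum c P (fun q => v q / c) p succn t_gt0.
Qed.

(** The integrand vanishes for [t >= c], so the integral stops at [min(b, c)]. If it stops at [c],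
    the upper boundary term is a residue sum at 1 over at least two poles, which is 0 by
    [residue_sum1], in agreement with the cutoff. *)
Lemma has_integral_residue a b c p P : 0 < a -> a < b -> 0 < c ->
  uniq (p :: P) -> (0 < size P)%N ->
  has_integral
    (fun t => if a < t < b then t ^+ p / t * truncated_residue P (c / t) else 0)
    (a ^+ p * truncated_residue (p :: P) (c / a) -
     b ^+ p * truncated_residue (p :: P) (c / b)).
Proof.
move=> a_gt0 lt_ab c_gt0 uniqpP P_gt0; have /andP[pNP _] := uniqpP.
have b_gt0 := lt_trans a_gt0 lt_ab.
have gt1E t : 0 < t -> (1 < c / t) = (t < c) by move=> t_gt0; rewrite ltr_pdivlMr ?mul1r.
rewrite /truncated_residue !gt1E //.
case: (ltP a c) => [lt_ac|le_ca]; last first.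
  rewrite ltNge (le_trans le_ca (ltW lt_ab)) /= !mulr0 subr0.
  rewrite (_ : (fun t => _) = fun=> 0); first exact: has_integral0.
  apply/funext => t; case: ifP => // /andP[lt_at _].
  rewrite gt1E ?(lt_trans a_gt0) // ltNge (le_trans le_ca (ltW lt_at)).
  by rewrite mulr0.
(* The hypotheses say that [b'] is the minimum of [b] and [c]. *)
have intE b' : a < b' -> b' <= b -> b' <= c -> (b' < b -> b' = c) ->
   (fun t => if a < t < b then
      t ^+ p / t * (if 1 < c / t then residue_sum P (c / t) else 0) else 0) =
   (fun t => if a < t < b' then t ^+ p / t * residue_sum P (c / t) else 0).
  move=> lt_ab' le_b'b le_b'c b'E; apply/funext => t.
  case: (ltP a t) => //= lt_at; rewrite gt1E ?(lt_trans a_gt0) //.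
  case: (ltP t b') => [lt_tb'|le_b't].
    by rewrite (lt_le_trans lt_tb' le_b'b) (lt_le_trans lt_tb' le_b'c).
  case: (ltP t b) => // lt_tb; rewrite ltNge -b'E ?le_b't ?mulr0 //.
  exact: le_lt_trans lt_tb.
case: (ltP b c) => [lt_bc|le_cb].
  rewrite (intE b) ?(ltW lt_bc) ?ltxx //.
  exact: has_integral_residue_lt.
rewrite (intE c) // mulr0.
have := has_integral_residue_lt a_gt0 lt_ac c_gt0 pNP.
by rewrite divff ?gt_eqF // residue_sum1 // mulr0.
Qed.

End StepIntegral.

(** * Monomials over the interlacing domain *)

Section MonomialIntegral.
Variable R : realType.
Implicit Types (y c t : R) (s x ys : seq R) (ps : seq nat).

(* The signed choices of endpoints: the lower end of each interval has sign 1, the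
   upper one sign -1, and the last, unbounded interval only has a lower end. *)
Fixpoint endpoints y ys : seq (R * seq R) :=
  if ys is y1 :: ys' then
    [seq (e.1, y :: e.2) | e <- endpoints y1 ys'] ++
    [seq (- e.1, y1 :: e.2) | e <- endpoints y1 ys']
  else [:: (1, [:: y])].

(** After the last upper end chosen, the next choice is the lower end of the following interval,
    which is the same point. Only the choice of lower ends throughout avoids such a repetition. *)
Lemma endpoints_uniq y ys :
  exists2 r, endpoints y ys = (1, y :: ys) :: r & all (fun e => ~~ uniq e.2) r.
Proof.
elim: ys y => [|y1 ys IHys] y /=; first by exists [::].
have [r -> rP] := IHys y1.
exists ([seq (e.1, y :: e.2) | e <- r] ++
        [seq (- e.1, y1 :: e.2) | e <- (1, y1 :: ys) :: r]); first by [].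
rewrite all_cat /= mem_head /= !all_map.
by apply/andP; split; apply: sub_all rP => e /=; apply: contra => /andP[].
Qed.

Lemma endpoints_gt0 y ys : path <%R y ys -> 0 < y ->
  {in endpoints y ys, forall e, 0 < \prod_(u <- e.2) u}.
Proof.
elim: ys y => [|y1 ys IHys] y /=.
  by move=> _ y_gt0 e; rewrite inE => /eqP->; rewrite big_seq1.
move=> /andP[lt_y pys] y_gt0 e; have y1_gt0 := lt_trans y_gt0 lt_y.
rewrite mem_cat => /orP[] /mapP[e' /(IHys _ pys y1_gt0) e'_gt0 ->].
  by rewrite big_cons mulr_gt0.
by rewrite big_cons mulr_gt0.
Qed.

(** A recursive form of [interlacing] with an arbitrary lower bound [y], so that an induction can
    integrate out the first variable. *)
Fixpoint interlaced y ys x : bool :=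
  match ys, x with
  | y1 :: ys', t :: x' => (y < t < y1) && interlaced y1 ys' x'
  | _, _ => y < x`_0
  end.

Definition monomial ps x : R := \prod_(i < size ps) x`_i ^+ nth 0%N ps i.

Lemma monomial_cons p ps t x : monomial (p :: ps) (t :: x) = t ^+ p * monomial ps x.
Proof. by rewrite /monomial big_ord_recl. Qed.

(** Fixing the first variable [t] replaces [c] by [c / t] in the remaining integral, which is known
    by induction. Integrating over [t] then adds the pole [p] to every residue sum and splits each
    term into its values at the two ends of the interval. *)
Lemma has_Rn_integral_monomial y ys ps c :
  0 < y -> path <%R y ys -> uniq ps -> size ps = (size ys).+1 -> 0 < c ->
  has_Rn_integral (size ys)
    (fun s => let x := rcons s (c / \prod_(t <- s) t) in
       if interlaced y ys x then monomial ps x / \prod_(t <- s) t else 0)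
    (\sum_(e <- endpoints y ys)
       e.1 * monomial ps e.2 * truncated_residue ps (c / \prod_(u <- e.2) u)).
Proof.
elim: ys y ps c => [|y1 ys IHys] y [|p ps] c //= y_gt0.
  case: ps => // _ _ _ c_gt0.
  (* With no integration left the variable equals [c], and [c^p = y^p (c/y)^p]. *)
  rewrite big_seq1 /= big_nil !big_seq1 divr1 /monomial !big_ord1 /= divr1 mul1r.
  rewrite /truncated_residue /residue_sum big_seq1 big_cons eqxx big_nil divr1.
  rewrite ltr_pdivlMr // mul1r.
  by case: ifP; rewrite ?mulr0 // expr_div_n mulrC divfK // expf_neq0 ?gt_eqF.
move=> /andP[lt_yy1 pys] /andP[pNps uniqps] [size_ps] c_gt0.
have y1_gt0 := lt_trans y_gt0 lt_yy1.
pose V c := \sum_(e <- endpoints y1 ys)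
  e.1 * monomial ps e.2 * truncated_residue ps (c / \prod_(u <- e.2) u).
exists (fun t => if y < t < y1 then t ^+ p / t * V (c / t) else 0).
  move=> t; case: ifP => lt_yty1; last first.
    apply: (@eq_has_Rn_integral _ _ (fun=> 0)) => [s _|] //.
    exact: has_Rn_integral0.
  have t_gt0 : 0 < t by apply: lt_trans y_gt0 _; case/andP: lt_yty1.
  have := has_Rn_integralZ (t ^+ p / t)
            (IHys y1 ps (c / t) y1_gt0 pys uniqps size_ps (divr_gt0 c_gt0 t_gt0)).
  apply: eq_has_Rn_integral => s _ /=; rewrite big_cons invfM !mulrA.
  case: ifP; rewrite ?mulr0 // => _.
  by rewrite monomial_cons -!mulrA; congr (_ * _); rewrite mulrCA.
pose f e t := e.1 * monomial ps e.2 * (if y < t < y1 then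
  t ^+ p / t * truncated_residue ps (c / (\prod_(u <- e.2) u) / t) else 0).
have -> : (fun t => if y < t < y1 then t ^+ p / t * V (c / t) else 0) =
          (fun t => \sum_(e <- endpoints y1 ys) f e t).
  apply/funext => t; rewrite /f; case: ifP => _; last first.
    by rewrite big1 // => e _; rewrite mulr0.
  rewrite mulr_sumr; apply: eq_bigr => e _.
  by rewrite mulrCA [c / t / _]mulrAC.
rewrite big_cat !big_map /= -big_split /=.
under eq_bigr do rewrite !monomial_cons !big_cons.
apply: has_integral_sum => e e_in.
have e_gt0 := endpoints_gt0 pys y1_gt0 e_in.
have cdivM u : c / (u * \prod_(j <- e.2) j) = c / \prod_(j <- e.2) j / u.
  by rewrite invfM mulrA mulrAC.
have := has_integralZ (e.1 * monomial ps e.2)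
  (@has_integral_residue R y y1 (c / \prod_(u <- e.2) u) p ps y_gt0 lt_yy1
     (divr_gt0 c_gt0 e_gt0) (introT andP (conj pNps uniqps)) _).
rewrite size_ps => /(_ isT).
rewrite !cdivM; set A := truncated_residue _ _; set B := truncated_residue _ _.
by congr has_integral; ring.
Qed.

End MonomialIntegral.

(** * Confluent determinants over the interlacing domain *)

Section ConfluentIntegral.
Variable R : realType.
Implicit Types (y ys x s : seq R) (z c : R).

Lemma size_endpoints (y : R) ys :
  {in endpoints y ys, forall e, size e.2 = (size ys).+1}.
Proof.
elim: ys y => [|y1 ys IHys] y /=; first by move=> e; rewrite inE => /eqP->.
by move=> e; rewrite mem_cat => /orP[] /mapP[e' /IHys e'P ->] /=; rewrite e'P.
Qed.

Definition confluent_det n k x (l : 'I_n -> nat) : R :=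
  \det (confluent_mx k (nth 0 x) l).

(** For injective [l] this is [residue_sum] over all the exponents. *)
Definition residue_weight n (l : 'I_n -> nat) z : R :=
  \sum_j z ^+ l j / (\prod_(q | q != j) ((l j)%:R - (l q)%:R)).

Lemma prod_confluent_mx n k x (l : 'I_n.+1 -> nat) (s : 'S_n.+1) : (k <= n.+1)%N ->
  \prod_(i < n.+1) (confluent_mx k (nth 0 x) l) i (s i) =
  monomial (mkseq ((l \o s) \o inord) k) x *
  \prod_(i < n.+1 | (k <= i)%N) 'C(l (s i), n - i)%:R.
Proof.
move=> le_kn; rewrite (bigID (fun i : 'I__ => (i < k)%N)) /=; congr (_ * _).
  rewrite /monomial size_mkseq.
  rewrite (big_ord_widen n.+1
    (fun i => x`_i ^+ nth 0%N (mkseq ((l \o s) \o inord) k) i)) //.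
  by apply: eq_bigr => i lt_ik; rewrite mxE lt_ik nth_mkseq //= inord_val.
apply: eq_big => [i|i]; first by rewrite -leqNgt.
by rewrite mxE => /negbTE->.
Qed.

Lemma has_Rn_integral_confluent n (l : 'I_n.+1 -> nat) ys z :
  injective l -> (size ys <= n)%N -> path <%R 1 ys -> 1 < z ->
  let k := size ys in
  has_Rn_integral k
    (fun s => let x := rcons s (z * \prod_(t <- ys) t / \prod_(t <- s) t) in
       if interlaced 1 ys x then confluent_det k.+1 x l / \prod_(t <- s) t else 0)
    ((-1) ^+ k * (n - k)`!%:R * confluent_det k ys l * residue_weight l z).
Proof.
move=> injl le_kn pys z_gt1 k; set c := z * _.
have ys_gt0 := endpoints_gt0 pys ltr01.
have [r endE r_dup] := endpoints_uniq 1 ys.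
have prod_ys_gt0 : 0 < \prod_(t <- ys) t.
  by have := ys_gt0 (1, 1 :: ys); rewrite endE mem_head big_cons mul1r; apply.
have c_gt0 : 0 < c by rewrite mulr_gt0 ?(lt_trans _ z_gt1).
pose P (g : 'S_n.+1) := mkseq ((l \o g) \o inord) k.+1.
have uniqP g : uniq (P g).
  rewrite map_inj_in_uniq ?iota_uniq // => i j; rewrite !mem_iota add0n => lti ltj.
  move=> /injl/perm_inj/(congr1 (@nat_of_ord _)).
  by rewrite !inordK //; apply: leq_trans le_kn.
pose rest (g : 'S_n.+1) : R := \prod_(i < n.+1 | (k.+1 <= i)%N) 'C(l (g i), n - i)%:R.
have prodE x (g : 'S_n.+1) : \prod_(i < n.+1) (confluent_mx k.+1 (nth 0 x) l) i (g i) =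
    monomial (P g) x * rest g by exact: prod_confluent_mx.
have := has_Rn_integral_sum (index_enum (perm_type 'I_n.+1)) (fun g : 'S_n.+1 =>
  has_Rn_integralZ ((-1) ^+ g * rest g)
    (has_Rn_integral_monomial ltr01 pys (uniqP g) (size_mkseq _ _) c_gt0)).
set V := \sum_(g <- _) _; have -> : V = (-1) ^+ k * (n - k)`!%:R *
    confluent_det k ys l * residue_weight l z.
  (* For a fixed choice of endpoints, the sum over permutations becomes a combination of
     determinants whose power rows are taken at these endpoints. *)
  have sumE (e : R * seq R) (d : R) :
    \sum_(g : 'S_n.+1) (-1) ^+ g * rest g *
      (e.1 * monomial (P g) e.2 * truncated_residue (P g) d) =
    e.1 * (if 1 < d then \sum_j d ^+ l j /
        (\prod_(q | q != j) ((l j)%:R - (l q)%:R)) *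
        \det (weighted_mx k.+1 (nth 0 e.2) l j) else 0).
    rewrite /truncated_residue; case: ifP => _; last first.
      by rewrite mulr0 big1 // => g _; rewrite !mulr0.
    rewrite -sum_det_residue // mulr_sumr; apply: eq_bigr => g _.
    rewrite prodE /P; move: (_ ^+ _) (rest g) (monomial _ _) (residue_sum _ _) => E A B C.
    by ring.
  rewrite /V; under eq_bigr do rewrite mulr_sumr.
  (* For the choice [1 :: ys] the argument of the residue sum is [z], which passes the cutoff. Every
     other choice repeats an endpoint and gives two equal rows. *)
  rewrite exchange_big /= endE big_cons [X in _ + X]big1_seq ?addr0 => [|e /andP[_ er]].
    rewrite sumE /= big_cons mul1r mul1r mulfK ?gt_eqF //.
    rewrite z_gt1 /residue_weight mulr_sumr; apply: eq_bigr => j _.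
    by rewrite det_weighted_mx1 // -/(confluent_det _ _ _) mulrC.
  rewrite sumE; case: ifP => _; rewrite ?mulr0 // big1 ?mulr0 // => j _.
  have size_e := @size_endpoints 1 ys e; rewrite endE inE er orbT in size_e.
  have /(uniqPn 0)[a [b [lt_ab lt_b eq_ab]]] := allP r_dup e er.
  rewrite size_e // in lt_b.
  have lt_bn : (b < n.+1)%N by apply: leq_trans lt_b _.
  have lt_an := ltn_trans lt_ab lt_bn.
  rewrite (@det_weighted_mx_dup _ _ _ _ _ _ (Ordinal lt_an) (Ordinal lt_bn)) ?mulr0 //.
    by rewrite -val_eqE /= ltn_eqF.
  exact: ltn_trans lt_ab lt_b.
apply: eq_has_Rn_integral => s size_s; set x := rcons _ _ => /=.
case: ifP => _; last by rewrite big1 // => i _; rewrite mulr0.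
rewrite /confluent_det /determinant mulr_suml; apply: eq_bigr => g _.
rewrite prodE; move: (_ ^+ _) (rest g) (monomial _ _) (_^-1) => E A B C.
by ring.
Qed.

End ConfluentIntegral.

(* The Newton expansion at the points 0, 1, 2, .. factors the Vandermonde matrix
   of the [l j] through the matrix of binomial coefficients. *)
Lemma det_binomial_neq0 (F : numFieldType) n (x : nat -> F) (l : 'I_n -> nat) :
  injective l -> \det (confluent_mx 0 x l) != 0.
Proof.
move=> injl.
pose H : 'M[F]_n := \matrix_(m, i)
  (newton_coef (fun r => r%:R) m (n.-1 - i) * (n.-1 - i)`!%:R).
have VE : Vandermonde n (\row_j (l j)%:R) = H *m confluent_mx 0 x l.
  apply/matrixP => m j; rewrite !mxE (expr_newton (fun r => r%:R) _ (ltn_ord m)).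
  rewrite (reindex_inj rev_ord_inj) /=; apply: eq_bigr => i _.
  rewrite !mxE /= -mulrA -natrM; have ltin := ltn_ord i.
  have -> : (n - i.+1 = n.-1 - i)%N by lia.
  congr (_ * _); set r := (n.-1 - i)%N.
  rewrite mulnC bin_ffact ffact_prod natr_prod.
  case: (leqP r (l j)) => [le_r|lt_r].
    by apply: eq_bigr => t _; rewrite natrB // (leq_trans (ltnW (ltn_ord t))).
  rewrite (bigD1 (Ordinal lt_r)) //= subrr mul0r.
  by rewrite (bigD1 (Ordinal lt_r)) //= subnn mul0r.
have : \det (Vandermonde n (\row_j (l j)%:R : 'rV[F]_n)) != 0.
  rewrite det_Vandermonde; apply/prodf_neq0 => i _; apply/prodf_neq0 => j lt_ij.
  rewrite !mxE subr_eq0 eqr_nat (inj_eq injl).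
  by rewrite eq_sym -val_eqE ltn_eqF.
by rewrite VE det_mulmx mulf_eq0 negb_or => /andP[].
Qed.

Section NormalizedIntegral.
Variable R : realType.
Implicit Types (ys : seq R) (z : R).

(** Without any [y] the integral is an evaluation at [z], so the integral formula itself identifies
    [residue_weight]. *)
Lemma confluent_det1 n (l : 'I_n.+1 -> nat) z : injective l -> 1 < z ->
  confluent_det 1 [:: z] l = n`!%:R * confluent_det 0 [::] l * residue_weight l z.
Proof.
move=> injl z_gt1; have := @has_Rn_integral_confluent R n l [::] z injl isT isT z_gt1.
by rewrite /= !big_nil !divr1 mulr1 z_gt1 subn0 mul1r.
Qed.

Lemma has_Rn_integral_confluent_det n (l : 'I_n.+1 -> nat) ys z :
  injective l -> (size ys <= n)%N -> path <%R 1 ys -> 1 < z ->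
  let k := size ys in
  has_Rn_integral k
    (fun s => let x := rcons s (z * \prod_(t <- ys) t / \prod_(t <- s) t) in
       if interlaced 1 ys x then confluent_det k.+1 x l / \prod_(t <- s) t else 0)
    ((-1) ^+ k * (n - k)`!%:R / n`!%:R * confluent_det k ys l *
     (confluent_det 1 [:: z] l / confluent_det 0 [::] l)).
Proof.
move=> injl le_kn pys z_gt1 k.
have := has_Rn_integral_confluent injl le_kn pys z_gt1.
rewrite -/k; congr has_Rn_integral; rewrite confluent_det1 //.
have := det_binomial_neq0 (nth 0 [::]) injl : confluent_det 0 [::] l != 0.
have : n`!%:R != 0 :> R by rewrite pnatr_eq0 -lt0n fact_gt0.
set f := n`!%:R; set d := confluent_det 0 _ _ => f0 d0.
field; apply/andP; split; [exact: d0 | exact: f0].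
Qed.

End NormalizedIntegral.

(** * Evaluation and span of the Schur functions *)

Section SchurEvaluation.
Variables (F : fieldType) (n : nat).
Implicit Types (lam : n.-tuple nat) (v : nat -> F).

Definition shifted_exponent lam (j : 'I_n) : nat := (tnth lam j + (n - j.+1))%N.

Lemma shifted_exponent_inj lam : is_partition lam -> injective (shifted_exponent lam).
Proof.
move=> lamP.
have dec (i j : 'I_n) : (i < j)%N -> (shifted_exponent lam j < shifted_exponent lam i)%N.
  move=> lt_ij; rewrite /shifted_exponent.
  have : (tnth lam j <= tnth lam i)%N.
    rewrite !(tnth_nth 0%N).
    apply: (sorted_leq_nth (leT := geq)) => //; last exact: ltnW.
    - by move=> a b c /= ba ac; apply: leq_trans ac ba.
    - by move=> a /=.
    - by rewrite inE size_tuple.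
    - by rewrite inE size_tuple.
  by have := ltn_ord i; have := ltn_ord j; lia.
move=> i j eq_ij; apply/val_inj.
by case: (ltngtP i j) => // /dec; rewrite eq_ij ltnn.
Qed.

(** Dividing the alternant by [Delta] in the polynomial ring leaves a determinant of Newton
    coefficients, of Jacobi-Trudi type, which can be evaluated at coinciding points. *)
Lemma meval_schur lam v :
  meval (fun i : 'I_n => v i) (val (schur F lam)) =
  \det (pow_newton_mx 0 v (shifted_exponent lam)).
Proof.
pose x (i : nat) : {mpoly F[n]} := oapp (fun j : 'I_n => mpolyX _ (mnm1 j)) 0 (insub i).
have xE (i : 'I_n) : x i = mpolyX _ (mnm1 i) by rewrite /x valK.
have -> : val (schur F lam) = \det (pow_newton_mx 0 x (shifted_exponent lam)).
  apply: (mulIf (Delta_X_neq0 F n)); rewrite schurE.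
  have -> : alternant F lam = \det (pow_newton_mx n x (shifted_exponent lam)).
    by congr (\det _); apply/matrixP => i j; rewrite !mxE ltn_ord xE.
  rewrite det_pow_newton_mx mulrC; congr (_ * _).
  rewrite /Delta; apply: eq_big => [i|i _]; first by rewrite ltn_ord.
  by apply: eq_bigr => j _; rewrite !xE.
rewrite rmorph_det_pow_newton; congr (\det _); apply/matrixP => i j; rewrite !mxE /=.
apply: eq_newton_coef => r _ /=.
have lt_n : (n.-1 - r < n)%N by have := ltn_ord i; lia.
by rewrite /x insubT /= mevalXU.
Qed.

End SchurEvaluation.

Section SympolyVal.
Variables (F : comNzRingType) (n : nat).
Implicit Types (f g : sympoly F n).

Lemma sympoly_val_inj : injective (@sympoly_val F n).
Proof. exact: val_inj. Qed.

Lemma sympoly_valD f g : sympoly_val (f + g) = sympoly_val f + sympoly_val g.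
Proof. by []. Qed.

Lemma sympoly_valZ a f : sympoly_val (a *: f) = a *: sympoly_val f.
Proof. by []. Qed.

Lemma sympoly_val0 : sympoly_val (0 : sympoly F n) = 0.
Proof. by []. Qed.

End SympolyVal.

Section Rho.
Variables (F : comNzRingType) (n : nat).
Implicit Types (f g : sympoly F n).

Lemma sympoly_val_rho k f : (k <= n)%N ->
  sympoly_val (rho k f) = comp_mpoly (rho_point F n k) (sympoly_val f).
Proof. exact: val_rho. Qed.

Lemma rhoD k f g : (k <= n)%N -> rho k (f + g) = rho k f + rho k g.
Proof.
move=> le_kn; apply: sympoly_val_inj; rewrite sympoly_val_rho //.
rewrite sympoly_valD comp_mpolyD [RHS]sympoly_valD.
by congr (_ + _); rewrite sympoly_val_rho.
Qed.

Lemma rhoZ k a f : (k <= n)%N -> rho k (a *: f) = a *: rho k f.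
Proof.
move=> le_kn; apply: sympoly_val_inj; rewrite sympoly_val_rho //.
by rewrite sympoly_valZ comp_mpolyZ [RHS]sympoly_valZ (sympoly_val_rho f le_kn).
Qed.

Lemma rho0 k : (k <= n)%N -> rho k (0 : sympoly F n) = 0.
Proof. by move=> le_kn; rewrite -[X in rho k X](scale0r 0) rhoZ // scale0r. Qed.

Lemma meval_rho k (v : nat -> F) f : (k <= n)%N ->
  meval (fun i : 'I_k => v i) (sympoly_val (rho k f)) =
  meval (fun i : 'I_n => if (i < k)%N then v i else 1) (sympoly_val f).
Proof.
move=> le_kn; rewrite (sympoly_val_rho _ le_kn) comp_mpoly_meval; apply: meval_eq => i.
rewrite tnth_mktuple; case: insubP => [j lt_ik val_j|] /=.
  by rewrite mevalXU val_j lt_ik.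
by move=> /negbTE->; rewrite meval1.
Qed.

End Rho.

Section SymEval.
Variable R : realType.
Local Notation C := R[i].
Implicit Types (x y : seq R) (z : R).

Lemma sym_evalD k x (f g : sympoly C k) :
  sym_eval x (f + g) = sym_eval x f + sym_eval x g.
Proof. by rewrite /sym_eval /= mevalD. Qed.

Lemma sym_evalZ k x a (f : sympoly C k) : sym_eval x (a *: f) = a * sym_eval x f.
Proof. by rewrite /sym_eval /= mevalZ. Qed.

Lemma sym_eval0 k x : sym_eval x (0 : sympoly C k) = 0.
Proof. by rewrite /sym_eval /= meval0. Qed.

Lemma symz_eval_wide k y z (p : {poly sympoly C k}) N : (size p <= N)%N ->
  symz_eval y z p = \sum_(i < N) sym_eval y p`_i * z%:C%C ^+ i.
Proof.
move=> le_N; rewrite /symz_eval (horner_coef_wide _ (n := N)).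
  by apply: eq_bigr => i _; rewrite coef_map_id0 // sym_eval0.
by apply: leq_trans (size_poly _ _) le_N.
Qed.

Lemma symz_evalD k y z (p q : {poly sympoly C k}) :
  symz_eval y z (p + q) = symz_eval y z p + symz_eval y z q.
Proof.
pose N := maxn (size p) (size q).
rewrite !(@symz_eval_wide _ _ _ _ N) ?leq_maxl ?leq_maxr ?size_polyD //.
rewrite -big_split; apply: eq_bigr => i _.
by rewrite coefD sym_evalD mulrDl.
Qed.

Lemma symz_evalZ k y z a (p : {poly sympoly C k}) :
  symz_eval y z (a%:A *: p) = a * symz_eval y z p.
Proof.
rewrite !(@symz_eval_wide _ _ _ _ (size p)) ?size_scale_leq //.
rewrite mulr_sumr; apply: eq_bigr => i _.
by rewrite coefZ mulr_algl sym_evalZ mulrA.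
Qed.

Lemma horner_q_lambda n (lam : n.-tuple nat) (z : C) :
  (q_lambda C lam).[z] =
  meval (fun i : 'I_n => if (i < 1)%N then z else 1) (val (nschur C lam)).
Proof.
rewrite /q_lambda /mmap mevalE horner_sum; apply: eq_bigr => m _.
rewrite hornerM hornerC; congr (_ * _); rewrite /mmap1 horner_prod.
apply: eq_bigr => i _; rewrite horner_exp ltnS leqn0 /=.
by case: ifP => _; rewrite ?hornerX ?hornerC.
Qed.

Lemma confluent_detC n k x (l : 'I_n -> nat) :
  \det (confluent_mx k (fun i => (x`_i)%:C%C : C) l) = (confluent_det k x l)%:C%C.
Proof. by rewrite /confluent_det (rmorph_det_confluent (real_complex R)). Qed.

Lemma meval1_schur n (lam : n.-tuple nat) :
  meval (fun=> 1) (val (schur C lam)) =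
  (confluent_det 0 [::] (shifted_exponent lam))%:C%C.
Proof.
rewrite (meval_schur lam (fun=> 1)) -confluent_detC det_confluent_mx //.
by rewrite /Delta !big_ord0 mulr1 mul1r.
Qed.

(** The weight of [f] in the integrand; with one variable fewer it is also the [y]-dependent
    denominator of the prefactor. *)
Definition Delta_weight n k x : R :=
  Delta (fun j : 'I_k => x`_j) * \prod_(j < k) (x`_j - 1) ^+ (n - k).

(** In product form the identity also holds where the weight vanishes. *)
Lemma sym_eval_nschur n k x (lam : n.-tuple nat) : (k <= n)%N -> is_partition lam ->
  (Delta_weight n k x)%:C%C * sym_eval x (rho k (nschur C lam)) =
  (confluent_det k x (shifted_exponent lam) /
   confluent_det 0 [::] (shifted_exponent lam))%:C%C.
Proof.
move=> le_kn lamP; rewrite /nschur rhoZ // sym_evalZ /sym_eval.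
rewrite (meval_rho (fun i => (x`_i)%:C%C)) //.
rewrite (meval_schur lam (fun i => if (i < k)%N then (x`_i)%:C%C else 1)).
rewrite meval1_schur.
transitivity ((confluent_det k x (shifted_exponent lam))%:C%C /
  (confluent_det 0 [::] (shifted_exponent lam))%:C%C); last by rewrite fmorph_div.
rewrite -(confluent_detC k x) mulrCA mulrC; congr (_ / _).
rewrite det_confluent_mx //; congr (_ * _).
rewrite /Delta_weight /Delta rmorphM !rmorph_prod; congr (_ * _).
  apply: eq_bigr => i _; rewrite rmorph_prod; apply: eq_bigr => j _.
  by rewrite rmorphB.
by apply: eq_bigr => i _; rewrite rmorphXn rmorphB rmorph1.
Qed.

End SymEval.

(** * The delta integral of normalized Schur functions *)

Section DeltaIntegral.
Variable R : realType.
Local Notation C := R[i].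
Implicit Types (x y s : seq R) (z c : R) (g : seq R -> C) (v : C).

Lemma interlacedE a y x : size x = (size y).+1 ->
  interlaced a y x =
  (a < x`_0) && [forall j : 'I_(size y), x`_j < y`_j < x`_j.+1].
Proof.
have forallE m (B : pred 'I_m) : [forall j, B j] = \big[andb/true]_(j < m) B j.
  by rewrite big_andE; apply: eq_forallb.
rewrite forallE; elim: y a x => [|y1 y IHy] a [|t x] //= [size_x].
  by rewrite big_ord0 andbT.
by rewrite IHy // big_ord_recl /= -!andbA.
Qed.

Lemma interlacingE k y x : size y = k -> size x = k.+1 ->
  interlacing k.+1 y x = interlaced 1 y x.
Proof. by move=> <- size_x; rewrite interlacedE. Qed.

Definition has_delta_integral k c (Omega : pred (seq R)) g v :=
  let h s : C :=
    let p := \prod_(t <- s) t in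
    let x := rcons s (c / p) in
    if Omega x then g x / p%:C%C else 0 in
  has_Rn_integral k.-1 (fun s => complex.Re (h s)) (complex.Re v) /\
  has_Rn_integral k.-1 (fun s => complex.Im (h s)) (complex.Im v).

Lemma has_delta_integralE k c Omega g v :
  has_delta_integral k c Omega g v -> delta_integral k c Omega g = v.
Proof.
case=> /has_Rn_integralE reE /has_Rn_integralE imE.
by rewrite /delta_integral reE imE; case: v {reE imE}.
Qed.

Lemma has_delta_integralD k c Omega g1 g2 v1 v2 :
  has_delta_integral k c Omega g1 v1 -> has_delta_integral k c Omega g2 v2 ->
  has_delta_integral k c Omega (fun x => g1 x + g2 x) (v1 + v2).
Proof.
move=> [re1 im1] [re2 im2]; split.
  rewrite raddfD; apply: eq_has_Rn_integral (has_Rn_integralD re1 re2) => s _ /=.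
  by case: ifP => _; rewrite ?addr0 // mulrDl raddfD.
rewrite raddfD; apply: eq_has_Rn_integral (has_Rn_integralD im1 im2) => s _ /=.
by case: ifP => _; rewrite ?addr0 // mulrDl raddfD.
Qed.

Lemma has_delta_integralZ k c Omega g v (a : C) :
  has_delta_integral k c Omega g v ->
  has_delta_integral k c Omega (fun x => a * g x) (a * v).
Proof.
have ReM (u w : C) : complex.Re (u * w) =
    complex.Re u * complex.Re w + - complex.Im u * complex.Im w.
  by case: u w => [u1 u2] [w1 w2] /=; rewrite mulNr.
have ImM (u w : C) : complex.Im (u * w) =
    complex.Re u * complex.Im w + complex.Im u * complex.Re w.
  by case: u w => [u1 u2] [w1 w2].
move=> [re im]; split.
  rewrite ReM; apply: eq_has_Rn_integral
    (has_Rn_integralD (has_Rn_integralZ _ re) (has_Rn_integralZ _ im)) => s _ /=.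
  by case: ifP => _; rewrite ?mulr0 ?addr0 // -mulrA [RHS]ReM.
rewrite ImM; apply: eq_has_Rn_integral
  (has_Rn_integralD (has_Rn_integralZ _ im) (has_Rn_integralZ _ re)) => s _ /=.
by case: ifP => _; rewrite ?mulr0 ?addr0 // -mulrA [RHS]ImM.
Qed.

Lemma eq_has_delta_integral k c Omega g1 g2 v : g1 =1 g2 ->
  has_delta_integral k c Omega g1 v -> has_delta_integral k c Omega g2 v.
Proof. by move=> /funext->. Qed.

Lemma has_delta_integral_real k c Omega (g : seq R -> R) (v : R) :
  has_Rn_integral k.-1 (fun s => let x := rcons s (c / \prod_(t <- s) t) in
    if Omega x then g x / \prod_(t <- s) t else 0) v ->
  has_delta_integral k c Omega (fun x => (g x)%:C%C) v%:C%C.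
Proof.
move=> gv; split; [move: gv|move: (has_Rn_integral0 R k.-1)];
  apply: eq_has_Rn_integral => s _ /=; case: ifP => // _.
  by rewrite -(fmorph_div (real_complex R)).
by rewrite -(fmorph_div (real_complex R)).
Qed.

Lemma has_delta_integral0 k c Omega : has_delta_integral k c Omega (fun=> 0) 0.
Proof.
apply: (@has_delta_integral_real _ _ _ (fun=> 0)).
apply: eq_has_Rn_integral (has_Rn_integral0 R k.-1) => s _ /=.
by case: ifP => _; rewrite ?mul0r.
Qed.

(** This brings the eigenvalue under the determinantal formula with one variable. *)
Lemma horner_q_lambda_rho n (lam : n.+1.-tuple nat) z :
  (q_lambda C lam).[z%:C%C] = sym_eval [:: z] (rho 1 (nschur C lam)).
Proof.
rewrite horner_q_lambda /sym_eval (meval_rho (fun i => ([:: z]`_i)%:C%C)) //.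
by apply: meval_eq => i; case: ifP => //; rewrite ltnS leqn0 => /eqP->.
Qed.

Lemma Delta_weight_neq0 n k y : size y = k -> path <%R 1 y -> Delta_weight n k y != 0.
Proof.
move=> size_y; rewrite lt_path_sortedE => /andP[/allP y_gt1 y_lt].
rewrite mulf_neq0 //.
  apply/prodf_neq0 => i _; apply/prodf_neq0 => j lt_ij; rewrite subr_eq0 lt_eqF //.
  by apply: (sorted_ltn_nth lt_trans) => //; rewrite inE size_y.
apply/prodf_neq0 => i _; rewrite expf_neq0 // subr_eq0 gt_eqF //.
by apply: y_gt1; rewrite mem_nth // size_y.
Qed.

Definition Ak_coef n k z y : R :=
  (-1) ^+ k.-1 * (n.-1)`!%:R
  / ((n - k)`!%:R * (z - 1) ^+ n.-1
     * Delta (fun j : 'I_k.-1 => y`_j)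
     * \prod_(j < k.-1) (y`_j - 1) ^+ (n - k + 1)).

(** Both factors on the left are ratios of confluent determinants. The integral is given through a
    value [v], so that integrability passes to linear combinations. *)
Lemma has_delta_integral_nschur n k (lam : n.+1.-tuple nat) y z :
  is_partition lam -> (k <= n)%N -> size y = k -> path <%R 1 y -> 1 < z ->
  exists2 v, has_delta_integral k.+1 (z * \prod_(j < k) y`_j) (interlacing k.+1 y)
      (fun x => (Delta_weight n.+1 k.+1 x)%:C%C *
                sym_eval x (rho k.+1 (nschur C lam))) v &
    sym_eval y (rho k (nschur C lam)) * (q_lambda C lam).[z%:C%C] =
    (Ak_coef n.+1 k.+1 z y)%:C%C * v.
Proof.
move=> lamP le_kn size_y py z_gt1; set l := shifted_exponent lam.
have injl : injective l := shifted_exponent_inj lamP.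
have d0 : confluent_det 0 [::] l != 0 :> R := det_binomial_neq0 _ injl.
have := has_Rn_integral_confluent_det injl _ py z_gt1.
rewrite size_y => /(_ le_kn) /= intD.
have J_neq0 := Delta_weight_neq0 n.+1 size_y py.
have := sym_eval_nschur y (leqW le_kn) lamP.
have := @sym_eval_nschur R n.+1 1 [:: z] lam isT lamP.
rewrite -horner_q_lambda_rho -/l.
have -> : Delta_weight n.+1 1 [:: z] = (z - 1) ^+ n.
  rewrite /Delta_weight /Delta !big_ord1 /= big_pred0 ?mul1r ?subn1 // => j.
  by rewrite [j]ord1.
have z_neq0 : (z - 1) ^+ n != 0 by rewrite expf_neq0 // subr_eq0 gt_eqF.
set J := Delta_weight n.+1 k y; set zn := (z - 1) ^+ n.
set D0 := confluent_det 0 [::] l; set D1 := confluent_det 1 _ _.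
set Dk := confluent_det k y l => q_eq rho_eq.
exists (((-1) ^+ k * (n - k)`!%:R / n`!%:R * Dk * (D1 / D0)) / D0)%:C%C.
  have := has_Rn_integralZ D0^-1 intD; rewrite [D0^-1 * (_ * _)]mulrC => {}intD.
  apply: (@eq_has_delta_integral _ _ _ (fun x => (confluent_det k.+1 x l / D0)%:C%C)).
    by move=> x; rewrite sym_eval_nschur.
  apply: has_delta_integral_real.
  have -> : \prod_(j < k) y`_j = \prod_(t <- y) t.
    by rewrite [RHS](big_nth 0) size_y big_mkord.
  apply: eq_has_Rn_integral intD => s size_s /=.
  rewrite interlacingE ?size_rcons ?size_s //.
  by case: ifP => _; rewrite ?mulr0 // mulrC mulrAC.
have -> : Ak_coef n.+1 k.+1 z y = (-1) ^+ k * n`!%:R / ((n - k)`!%:R * zn * J).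
  by rewrite /Ak_coef /= -/zn /J /Delta_weight subSS addn1 -subSn // !mulrA.
have zn_C : zn%:C%C != 0 by rewrite fmorph_eq0.
have J_C : J%:C%C != 0 by rewrite fmorph_eq0.
have -> : sym_eval y (rho k (nschur C lam)) = (Dk / D0 / J)%:C%C.
  by apply: (mulfI J_C); rewrite rho_eq -rmorphM; congr (_%:C%C); rewrite [RHS]mulrC divfK.
have -> : (q_lambda C lam).[z%:C%C] = (D1 / D0 / zn)%:C%C.
  by apply: (mulfI zn_C); rewrite q_eq -rmorphM; congr (_%:C%C); rewrite [RHS]mulrC divfK.
rewrite -!rmorphM; congr (_%:C%C).
have f1 : n`!%:R != 0 :> R by rewrite pnatr_eq0 -lt0n fact_gt0.
have f2 : (n - k)`!%:R != 0 :> R by rewrite pnatr_eq0 -lt0n fact_gt0.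
have sgn1 : (-1) ^+ k * (-1) ^+ k = 1 :> R by rewrite -expr2 sqrr_sign.
have {}d0 : D0 != 0 := d0.
have {}J_neq0 : J != 0 := J_neq0.
have {}z_neq0 : zn != 0 := z_neq0.
clearbody J zn D0 D1 Dk.
move: (n`!%:R) f1 (_`!%:R) f2 (_ ^+ k) sgn1 => A A0 B B0 e e2.
(* The sign [(-1)^k] occurs both in the prefactor and in the integral. *)
transitivity (e * e * (Dk / D0 / J * (D1 / D0 / zn))); first by rewrite e2 mul1r.
field; do ?[apply/andP; split];
  [exact: d0 | exact: A0 | exact: J_neq0 | exact: z_neq0 | exact: B0].
Qed.

End DeltaIntegral.

(** Distinct exponents sorted in decreasing order dominate the staircase [n-1, .., 0]; subtracting
    it leaves a partition. *)
Lemma partition_of_injective n (e : 'I_n -> nat) : injective e ->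
  exists (lam : n.-tuple nat) (s : 'S_n),
    is_partition lam /\ forall j, shifted_exponent lam j = e (s j).
Proof.
move=> inje; pose t := [tuple e i | i < n].
have /tuple_permP[s sE] : perm_eq (sort geq t) t by rewrite perm_sort.
pose S := sort geq t.
have size_S : size S = n by rewrite size_sort size_tuple.
have SE (i : 'I_n) : nth 0%N S i = e (s i).
  by rewrite /S sE -tnth_nth !tnth_mktuple.
have uniqS : uniq S.
  by rewrite sort_uniq map_inj_uniq ?enum_uniq.
have Ssorted : sorted geq S by apply: sort_sorted => i j; apply: leq_total.
have Sgt i : (i.+1 < n)%N -> (nth 0%N S i.+1 < nth 0%N S i)%N.
  move=> lt_in; have /(sortedP 0%N)/(_ i) := Ssorted.
  rewrite size_S lt_in => /(_ isT) /= leS.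
  rewrite ltn_neqAle leS andbT nth_uniq ?size_S // ?(ltnW lt_in) //.
  by rewrite gtn_eqF.
have Sge i : (i < n)%N -> (n - i.+1 <= nth 0%N S i)%N.
  move=> lt_in; have [m mE] : exists m, m = (n - i.+1)%N by eexists.
  elim: m i lt_in mE => [|m IHm] i lt_in mE; first by rewrite -mE.
  have := Sgt i; have := IHm i.+1; lia.
pose lam := [tuple (nth 0%N S i - (n - i.+1))%N | i < n].
exists lam, s; split.
  apply/(sortedP 0%N) => i; rewrite size_tuple => lt_in.
  have lt_i := ltnW lt_in.
  have lamE j (lt_jn : (j < n)%N) : nth 0%N lam j = (nth 0%N S j - (n - j.+1))%N.
    by rewrite -[j]/(val (Ordinal lt_jn)) -tnth_nth tnth_mktuple.
  rewrite /= !lamE //; have := Sgt i lt_in; have := Sge i lt_i.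
  by have := Sge i.+1 lt_in; lia.
by move=> j; rewrite /shifted_exponent tnth_mktuple subnK ?Sge // SE.
Qed.

Section SchurSpan.
Variables (F : numFieldType) (n : nat).
Local Notation Delta_X := (Delta (fun i : 'I_n => mpolyX _ (mnm1 i) : {mpoly F[n]})).

Lemma meval1_schur_neq0 (lam : n.-tuple nat) : is_partition lam ->
  meval (fun=> 1) (sympoly_val (schur F lam)) != 0.
Proof.
move=> lamP; rewrite (meval_schur lam (fun=> 1)).
have := det_binomial_neq0 (fun=> 1 : F) (shifted_exponent_inj lamP).
by rewrite det_confluent_mx // /Delta !big_ord0 !mul1r.
Qed.

Lemma schur_nschur (lam : n.-tuple nat) : is_partition lam ->
  schur F lam = meval (fun=> 1) (sympoly_val (schur F lam)) *: nschur F lam.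
Proof. by move=> lamP; rewrite /nschur scalerA mulfV ?scale1r // meval1_schur_neq0. Qed.

Definition pow_det (e : 'I_n -> nat) : {mpoly F[n]} :=
  \det (\matrix_(i < n, j < n) mpolyX _ (mnm1 i) ^+ e j).

(** The signed sum of [msym s A] over all permutations is computed in two ways: by antisymmetry, and
    monomial by monomial. *)
Lemma antisymmetrize (A : {mpoly F[n]}) :
  (forall s : 'S_n, msym s A = (-1) ^+ s * A) ->
  n`!%:R * A = \sum_(m <- msupp A) mcoeff m A *: pow_det m.
Proof.
move=> antiA.
have <- : \sum_(s : 'S_n) (-1) ^+ s * msym s A = n`!%:R * A.
  under eq_bigr do rewrite antiA mulrA -expr2 sqrr_sign mul1r.
  by rewrite sumr_const card_Sn mulr_natl.
transitivity (\sum_(s : 'S_n) \sum_(m <- msupp A)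
    mcoeff m A *: ((-1) ^+ s * \prod_(i < n) mpolyX F (mnm1 (s i)) ^+ m i)).
  apply: eq_bigr => s _; rewrite {1}[A]mpolyE raddf_sum mulr_sumr.
  apply: eq_bigr => m _; rewrite /= msymZ -scalerAr; congr (_ *: (_ * _)).
  rewrite /msym mmapX /mmap1; apply: eq_bigr => i _.
  by [].
rewrite exchange_big; apply: eq_bigr => m _ /=; rewrite -scaler_sumr; congr (_ *: _).
rewrite /pow_det -det_tr; apply: eq_bigr => s _; congr (_ * _).
by apply: eq_bigr => i _; rewrite !mxE.
Qed.

(** The spanning property as an induction principle. The product of [f] and [Delta] is
    antisymmetric, hence a combination of determinants [pow_det]; each is 0 or, up to sign, an
    alternant, and [Delta] is cancelled. *)
Lemma nschur_ind (P : sympoly F n -> Prop) :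
  P 0 -> (forall f g, P f -> P g -> P (f + g)) -> (forall a f, P f -> P (a *: f)) ->
  (forall lam, is_partition lam -> P (nschur F lam)) -> forall f, P f.
Proof.
move=> P0 PD PZ Pschur f.
have pow_detP e : exists2 g, P g & sympoly_val g * Delta_X = pow_det e.
  have [/injectiveP inje|/injectivePn[i [j ne_ij eq_ij]]] := boolP (injectiveb e).
    have [lam [s [lamP lamE]]] := partition_of_injective inje.
    exists ((-1) ^+ s *: schur F lam).
      by apply: (PZ); rewrite schur_nschur //; apply: (PZ); apply: Pschur.
    rewrite sympoly_valZ -scalerAl schurE /alternant /pow_det.
    pose M : 'M[{mpoly F[n]}]_n := \matrix_(i, j) mpolyX _ (mnm1 i) ^+ e j.
    have -> : \det (\matrix_(i < n, j < n)
        (mpolyX _ (mnm1 i) : {mpoly F[n]}) ^+ (tnth lam j + (n - j.+1))) =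
        (-1) ^+ s * \det M.
      rewrite mulrC -[s]invgK odd_permV -det_perm -det_mulmx -col_permE.
      congr (\det _); apply/matrixP => i j; rewrite !mxE -lamE //.
    rewrite -mul_mpolyC rmorphXn rmorphN rmorph1 mulrA -expr2.
    by rewrite sqrr_sign mul1r.
  exists 0; rewrite // sympoly_val0 mul0r /pow_det -det_tr.
  by rewrite (determinant_alternate ne_ij) // => k; rewrite !mxE eq_ij.
have /choice[G GP] e : exists g, P g /\ sympoly_val g * Delta_X = pow_det e.
  by have [g Pg gE] := pow_detP e; exists g.
pose g := n`!%:R^-1 *: \sum_(m <- msupp (sympoly_val f * Delta_X))
  mcoeff m (sympoly_val f * Delta_X) *: G m.
suff -> : f = g.
  apply: (PZ); elim/big_ind: _ => // m _; apply: (PZ); exact: (GP m).1.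
have n_neq0 : n`!%:R != 0 :> F by rewrite pnatr_eq0 -lt0n fact_gt0.
apply: sympoly_val_inj; apply: (mulIf (Delta_X_neq0 F n)).
rewrite /g sympoly_valZ -scalerAl.
apply: (scalerI n_neq0); rewrite scalerA mulfV // scale1r.
rewrite -[LHS]mul_mpolyC mpolyC_nat antisymmetrize; last first.
  move=> s; rewrite msymM msym_Delta.
  have /issymP -> := valP f; by rewrite mulrCA.
rewrite (big_morph _ (@sympoly_valD F n) (sympoly_val0 F n)) mulr_suml.
by apply: eq_bigr => m _; rewrite sympoly_valZ -scalerAl (GP m).2.
Qed.

End SchurSpan.

(** * Surjectivity of the specializations *)

Section ElementarySums.
Variable A : idomainType.

Definition esum_at n (x : 'I_n -> A) (i : nat) : A :=
  \sum_(h : {set 'I_n} | #|h| == i) \prod_(j in h) x j.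

(** Vieta's formula; invariance under permutations and under padding by zeros is then read off the
    product. *)
Lemma esum_at_coef n (x : 'I_n -> A) i : (i <= n)%N ->
  esum_at x i = (-1) ^+ i * (\prod_(j < n) ('X - (x j)%:P))`_(n - i).
Proof.
move=> le_in; have := mroots_coeff [tuple x j | j < n] (Ordinal (le_in : (i < n.+1)%N)).
rewrite /= big_map big_enum /= => ->; rewrite mulrA -expr2 sqrr_sign mul1r.
rewrite /mesym raddf_sum; apply: eq_bigr => h _; rewrite /= rmorph_prod.
by apply: eq_bigr => j _; rewrite /= mevalXU tnth_mktuple.
Qed.

Lemma esum_at_perm n (x : 'I_n -> A) i (s : 'S_n) : (i <= n)%N ->
  esum_at (x \o s) i = esum_at x i.
Proof.
move=> le_in; rewrite !esum_at_coef //; congr (_ * _).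
by rewrite [in RHS](reindex_inj (@perm_inj _ s)).
Qed.

Lemma esum_at_pad n k (x : nat -> A) i : (i <= k)%N -> (k <= n)%N ->
  (forall j, (k <= j)%N -> x j = 0) ->
  esum_at (fun j : 'I_n => x j) i = esum_at (fun j : 'I_k => x j) i.
Proof.
move=> le_ik le_kn x0; rewrite !esum_at_coef ?(leq_trans le_ik) //; congr (_ * _).
have -> : \prod_(j < n) ('X - (x j)%:P) = \prod_(j < k) ('X - (x j)%:P) * 'X^(n - k).
  rewrite -(subnKC le_kn) big_split_ord /= addKn; congr (_ * _).
  rewrite -[X in 'X^X]card_ord -prodr_const; apply: eq_bigr => j _.
  by rewrite x0 ?leq_addr // subr0.
by rewrite coefMXn; case: ifP => [|_]; [lia | congr _`_ _; lia].
Qed.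

End ElementarySums.

Lemma rmorph_esum_at (A B : idomainType) (phi : {rmorphism A -> B}) n (x : 'I_n -> A) i :
  phi (esum_at x i) = esum_at (phi \o x) i.
Proof. by rewrite rmorph_sum; apply: eq_bigr => h _; rewrite rmorph_prod. Qed.

Section Surjectivity.
Variable F : fieldType.

Lemma comp_mpoly_comp n m k (t : {mpoly F[n]}) (T : n.-tuple {mpoly F[m]})
    (U : m.-tuple {mpoly F[k]}) :
  comp_mpoly U (comp_mpoly T t) = comp_mpoly [tuple comp_mpoly U (tnth T i) | i < n] t.
Proof.
rewrite !(comp_mpolyEX t) raddf_sum; apply: eq_bigr => m' _.
rewrite /= comp_mpolyZ; congr (_ *: _); rewrite !comp_mpolyX rmorph_prod.
by apply: eq_bigr => i _; rewrite tnth_mktuple rmorphXn.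
Qed.

(** Translating by 1 turns the ones inserted by [rho] into zeros, to which elementary symmetric
    polynomials are insensitive. *)
Definition shift n (a : F) : n.-tuple {mpoly F[n]} :=
  [tuple mpolyX _ (mnm1 i) + mpolyC n a | i < n].

Lemma shiftK n (f : {mpoly F[n]}) :
  comp_mpoly (shift n (-1)) (comp_mpoly (shift n 1) f) = f.
Proof.
rewrite comp_mpoly_comp -[RHS]comp_mpoly_id; congr comp_mpoly.
apply: eq_from_tnth => i; rewrite !tnth_mktuple comp_mpolyD comp_mpolyC comp_mpolyXU.
by rewrite -tnth_nth tnth_mktuple -addrA -mpolyCD addNr addr0.
Qed.

Lemma shift_sym n a (f : {mpoly F[n]}) :
  f \is symmetric -> comp_mpoly (shift n a) f \is symmetric.
Proof.
move=> symf; apply: msym_comp_poly => // s.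
have -> : [tuple msym s (shift n a)`_i | i < n] = [tuple tnth (shift n a) (s i) | i < n].
  apply: eq_from_tnth => i; rewrite !tnth_mktuple -tnth_nth tnth_mktuple.
  by rewrite raddfD /= /msym mmapX mmap1U mmapC.
by rewrite perm_sym; apply/tuple_permP; exists s.
Qed.

Lemma comp_shift_mesym n i :
  comp_mpoly (shift n (-1)) (mesym n F i) = esum_at (tnth (shift n (-1))) i.
Proof.
rewrite /mesym raddf_sum; apply: eq_bigr => h _; rewrite /= rmorph_prod.
by apply: eq_bigr => j _; rewrite /= comp_mpolyXU -tnth_nth.
Qed.

(** The translate of [f] is a polynomial [t] in the elementary symmetric polynomials of [k]
    variables. The preimage is the same [t] at those of [x_1 - 1, .., x_n - 1]. *)
Lemma rho_surj n k (f : sympoly F k) : (k <= n)%N -> exists g : sympoly F n, rho k g = f.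
Proof.
move=> le_kn.
have [t [tE _]] := sym_fundamental (shift_sym 1 (valP f)).
pose E : k.-tuple {mpoly F[n]} := [tuple esum_at (tnth (shift n (-1))) i.+1 | i < k].
have symg : comp_mpoly E t \is symmetric.
  rewrite comp_mpolyEX; apply: rpred_sum => m _; apply: rpredZ.
  rewrite comp_mpolyX; apply: rpred_prod => i _; apply: rpredX.
  rewrite tnth_mktuple; apply/issymP => s.
  rewrite (rmorph_esum_at (msym s)) -[RHS](@esum_at_perm _ _ _ _ s); last first.
    exact: leq_trans le_kn.
  congr esum_at; apply/funext => j; rewrite /= !tnth_mktuple.
  by rewrite raddfD /= /msym mmapX mmap1U mmapC.
exists (Sympoly symg); apply: sympoly_val_inj; rewrite sympoly_val_rho //=.
rewrite -[RHS]shiftK -tE !comp_mpoly_comp; congr comp_mpoly.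
apply: eq_from_tnth => i; rewrite !tnth_mktuple comp_shift_mesym.
rewrite (rmorph_esum_at (comp_mpoly (rho_point F n k))).
pose x j : {mpoly F[k]} := oapp (fun j : 'I_k => mpolyX _ (mnm1 j) - 1) 0 (insub j).
have -> : tnth (shift k (-1)) = (fun j : 'I_k => x j).
  by apply/funext => j; rewrite tnth_mktuple /x valK mpolyCN.
rewrite -(@esum_at_pad _ n) //; last first.
  by move=> j le_kj; rewrite /x insubF // ltnNge le_kj.
congr esum_at; apply/funext => j /=.
rewrite tnth_mktuple comp_mpolyD comp_mpolyC comp_mpolyXU -tnth_nth tnth_mktuple.
have -> : mpolyC k (-1 : F) = -1 by rewrite mpolyCN.
by rewrite /x; case: insub => [j'|] //=; rewrite subrr.
Qed.

End Surjectivity.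

(** * Polynomials vanishing at ordered real points *)

Section Vanishing.
Variable R : realType.
Local Notation C := R[i].

Lemma poly_eq0_gt1 (p : {poly C}) :
  (forall t : R, 1 < t -> p.[t%:C%C] = 0) -> p = 0.
Proof.
move=> p0; pose rs := [seq (j.+2%:R : R)%:C%C | j <- iota 0 (size p)].
apply: (@roots_geq_poly_eq0 _ _ rs); last by rewrite size_map size_iota.
  by apply/allP => _ /mapP[j _ ->]; rewrite rootE p0 ?ltr1n.
rewrite map_inj_uniq ?iota_uniq // => i j /complexI /eqP.
by rewrite eqr_nat !eqSS => /eqP.
Qed.

Lemma digits_inj N m (a b : nat -> nat) :
  (forall i, (i < m)%N -> (a i < N)%N) -> (forall i, (i < m)%N -> (b i < N)%N) ->
  (\sum_(i < m) a i * N ^ i = \sum_(i < m) b i * N ^ i)%N ->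
  forall i, (i < m)%N -> a i = b i.
Proof.
elim: m a b => [|m IHm] a b // aN bN.
have stepE (c : nat -> nat) : (\sum_(i < m.+1) c i * N ^ i =
    (\sum_(i < m) c i.+1 * N ^ i) * N + c 0)%N.
  rewrite big_ord_recl muln1 addnC big_distrl; congr (_ + _)%N.
  by apply: eq_bigr => i _; rewrite /= /bump /= expnSr mulnA.
rewrite !stepE => eqS.
have a0 : a 0%N = b 0%N.
  have /(congr1 (fun x => x %% N)%N) := eqS.
  by rewrite !modnMDl !modn_small ?aN ?bN.
have N_gt0 : (0 < N)%N by apply: leq_ltn_trans (aN 0%N isT).
have {}eqS : (\sum_(i < m) a i.+1 * N ^ i = \sum_(i < m) b i.+1 * N ^ i)%N.
  by apply/eqP; rewrite -(eqn_pmul2r N_gt0); move: eqS; rewrite a0 => /addIn->.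
move=> [|i] // lt_im; apply: (IHm (a \o succn) (b \o succn)) => // j;
  [exact: (aN j.+1) | exact: (bN j.+1)].
Qed.

(* Kronecker's substitution y_i = t ^ (N ^ i), with N above all the exponents. *)
Lemma mpoly_eq0_path m (p : {mpoly C[m]}) :
  (forall y : seq R, size y = m -> path <%R 1 y ->
     meval (fun i : 'I_m => (y`_i)%:C%C) p = 0) -> p = 0.
Proof.
(* The summand 2 ensures [1 < N] even for [p = 0], so that the points [t ^ (N ^ i)] increase
   strictly. *)
move=> p0; pose N := (msize p).+2.
pose w (e : multinom m) := (\sum_(i < m) e i * N ^ i)%N.
pose P : {poly C} := \sum_(e <- msupp p) mcoeff e p *: 'X^(w e).
have P0 : P = 0.
  apply: poly_eq0_gt1 => t t_gt1.
  pose y := mkseq (fun i => t ^+ (N ^ i)) m.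
  rewrite -(p0 y) ?size_mkseq //; last first.
    rewrite lt_path_sortedE; apply/andP; split.
      apply/allP => _ /mapP[i _ ->]; rewrite exprn_egt1 //.
      by rewrite -lt0n expn_gt0.
    apply/(sortedP 0) => i; rewrite size_mkseq => lt_im.
    rewrite !nth_mkseq ?(ltnW lt_im) //.
    by rewrite ltr_eXn2l // ltn_exp2l.
  rewrite mevalE horner_sum; apply: eq_bigr => e _.
  rewrite hornerZ hornerXn; congr (_ * _); rewrite /w expr_sum.
  apply: eq_bigr => i _; rewrite nth_mkseq // rmorphXn -exprM.
  by rewrite mulnC.
apply/mpolyP => e; rewrite mcoeff0.
have [e_in|/memN_msupp_eq0//] := boolP (e \in msupp p).
have /(congr1 (fun q : {poly C} => q`_(w e))) := P0.
rewrite coef0 coef_sum (bigD1_seq e) //= coefZ coefXn eqxx mulr1.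
rewrite big1_seq ?addr0 // => e' /andP[ne_e' e'_in].
rewrite coefZ coefXn; case: eqP => [eq_w|]; last by rewrite mulr0.
case/eqP: ne_e'; apply/mnmP => i.
pose digit (e1 : multinom m) j := oapp (fun j : 'I_m => e1 j) 0%N (insub j).
have digitE e1 (j : 'I_m) : digit e1 j = e1 j by rewrite /digit valK.
have digitN e1 : e1 \in msupp p -> forall j, (j < m)%N -> (digit e1 j < N)%N.
  move=> e1_in j lt_jm; rewrite -[j]/(val (Ordinal lt_jm)) digitE.
  have := msize_mdeg_lt e1_in; rewrite mdegE (bigD1 (Ordinal lt_jm)) //=.
  by rewrite /N; lia.
rewrite -!digitE; apply: (@digits_inj N m) => //; try exact: digitN.
rewrite /w in eq_w; under eq_bigr do rewrite digitE.
by under [RHS]eq_bigr do rewrite digitE.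
Qed.

End Vanishing.

(** * The separating operator and the operators A_k *)

Section SeparatingOperator.
Variables (F : numFieldType) (n : nat).
Local Notation S := (sympoly F n).

Lemma mcoeff_map_rho k (g : {mpoly S[n]}) m : (k <= n)%N ->
  mcoeff m (map_mpoly (@rho F n k) g) = rho k (mcoeff m g).
Proof.
move=> le_kn.
have rho_lin : linear (@rho F n k) by move=> a f h; rewrite rhoD // rhoZ.
pose rhoL : {linear S -> sympoly F k} :=
  HB.pack (@rho F n k) (GRing.isLinear.Build _ _ _ _ (@rho F n k) rho_lin).
exact: (mcoeff_map_mpoly rhoL).
Qed.

Lemma zsubst_map (A B : comNzRingType) (f : {rmorphism A -> B}) (j : 'I_n)
    (p : {poly A}) :
  zsubst j (map_poly f p) = map_mpoly f (zsubst j p).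
Proof.
rewrite /zsubst -horner_map /= map_mpolyX -!map_poly_comp; congr (_.[_]).
by apply: eq_map_poly => a /=; rewrite map_mpolyC.
Qed.

Lemma zsubstZ (A : comNzRingType) (j : 'I_n) (c : A) (p : {poly A}) :
  zsubst j (c *: p) = c *: zsubst j p.
Proof. by rewrite /zsubst map_polyZ hornerZ mul_mpolyC. Qed.

Lemma rho0_nschur (lam : n.-tuple nat) : is_partition lam -> rho 0 (nschur F lam) = 1.
Proof.
move=> lamP; apply: sympoly_val_inj; rewrite sympoly_val_rho //.
have compE (p : {mpoly F[n]}) :
    comp_mpoly (rho_point F n 0) p = mpolyC 0 (meval (fun=> 1) p).
  rewrite comp_mpolyEX mevalE raddf_sum; apply: eq_bigr => m _.
  rewrite comp_mpolyX !big1 => [|i _|i _]; first by rewrite mulr1 -mul_mpolyC mulr1.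
    by rewrite expr1n.
  by rewrite tnth_mktuple insubF // expr1n.
rewrite compE /nschur sympoly_valZ mevalZ mulVf //.
exact: meval1_schur_neq0.
Qed.

Variables (Q : zoperator F n n) (QE : is_Qz Q).

Lemma mcoeff_lift lam (P : {mpoly F[n]}) m :
  mcoeff m (mpolyC n (nschur F lam) * map_mpoly (in_alg S) P) =
  mcoeff m P *: nschur F lam.
Proof. by rewrite mcoeffCM mcoeff_map_mpoly /= mulr_algr. Qed.

Lemma Qz_scale a lam : is_partition lam ->
  Q (a *: nschur F lam) =
  (a *: nschur F lam) *: map_poly (in_alg S) (q_lambda F lam).
Proof.
move=> lamP; rewrite linearZ /= QE // scalerA; congr (_ *: _).
by rewrite mulr_algl.
Qed.

(** Multiples of [nschur F lam] by polynomials in [z] alone are stable under every [Qz_ext Q j], so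
    the eigenvalues accumulate as a product. *)
Lemma Qz_ext_nschur lam j (P : {mpoly F[n]}) : is_partition lam ->
  let lift P := mpolyC n (nschur F lam) * map_mpoly (in_alg S) P in
  Qz_ext Q j (lift P) = lift (P * zsubst j (q_lambda F lam)).
Proof.
move=> lamP lift; rewrite /lift rmorphM /= mulrA -zsubst_map -/(lift P) /Qz_ext.
have coefE m : mcoeff m (lift P) = mcoeff m P *: nschur F lam.
  exact: mcoeff_lift.
under eq_bigr do rewrite coefE Qz_scale // -coefE zsubstZ -scalerAl mulrC scalerAl.
by rewrite -mulr_suml -mpolyE.
Qed.

Lemma separating_nschur lam : is_partition lam ->
  separating Q (nschur F lam) =
  \prod_(j < n) zsubst j (map_poly (in_alg (sympoly F 0)) (q_lambda F lam)).
Proof.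
move=> lamP; pose lift P := mpolyC n (nschur F lam) * map_mpoly (in_alg S) P.
have -> : \prod_(j < n) zsubst j (map_poly (in_alg (sympoly F 0)) (q_lambda F lam)) =
    map_mpoly (in_alg (sympoly F 0)) (\prod_(j <- enum 'I_n) zsubst j (q_lambda F lam)).
  by rewrite rmorph_prod big_enum; apply: eq_bigr => j _; rewrite zsubst_map.
have foldE (r : seq 'I_n) : foldr (Qz_ext Q) (mpolyC n (nschur F lam)) r =
    lift (\prod_(j <- r) zsubst j (q_lambda F lam)).
  elim: r => [|j r IHr]; first by rewrite big_nil /lift rmorph1 mulr1.
  rewrite big_cons [zsubst _ _ * _]mulrC -[RHS]Qz_ext_nschur //.
  exact: congr1 IHr.
rewrite /separating foldE; apply/mpolyP => m.
rewrite [RHS]mcoeff_map_mpoly [LHS]mcoeff_map_rho // /lift.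
rewrite mcoeff_lift rhoZ // rho0_nschur //.
Qed.

End SeparatingOperator.

(** * Factorization through the specialization *)

Section FactorOperator.
Variables (R : realType) (n : nat).
Local Notation C := R[i].
Variables (Q : zoperator C n.+1 n.+1) (QE : is_Qz Q) (k : nat) (le_kn : (k <= n)%N).

Let le_k1n1 : (k.+1 <= n.+1)%N := le_kn.
Let le_kn1 : (k <= n.+1)%N := leqW le_kn.

Definition rhoQ (g : sympoly C n.+1) : {poly (sympoly C k)} := map_poly (rho k) (Q g).

Lemma coef_rhoQ g i : (rhoQ g)`_i = rho k (Q g)`_i.
Proof. by rewrite /rhoQ coef_map_id0 // rho0. Qed.

Lemma rhoQD f g : rhoQ (f + g) = rhoQ f + rhoQ g.
Proof.
apply/polyP => i; rewrite [LHS]coef_rhoQ linearD [X in rho k X]coefD rhoD // [RHS]coefD.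
by congr (_ + _); rewrite [RHS]coef_rhoQ.
Qed.

Lemma rhoQZ a g : rhoQ (a *: g) = a%:A *: rhoQ g.
Proof.
apply/polyP => i; rewrite [LHS]coef_rhoQ linearZ /= coefZ [RHS]coefZ.
by rewrite !mulr_algl rhoZ //; congr (_ *: _); rewrite [RHS]coef_rhoQ.
Qed.

Lemma rhoQ0 : rhoQ 0 = 0.
Proof. by rewrite -[X in rhoQ X](scale0r 0) rhoQZ scale0r scale0r. Qed.

Lemma symz_eval_nschur y z lam : is_partition lam ->
  symz_eval y z (rhoQ (nschur C lam)) =
  sym_eval y (rho k (nschur C lam)) * (q_lambda C lam).[z%:C%C].
Proof.
move=> lamP; set q := q_lambda C lam.
rewrite (@symz_eval_wide _ _ _ _ _ (size q)).
  rewrite horner_coef mulr_sumr; apply: eq_bigr => i _.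
  rewrite coef_rhoQ QE // coefZ coef_map /= mulr_algr rhoZ // sym_evalZ.
  by rewrite -mulrA mulrCA.
apply: leq_trans (size_poly _ _) _; rewrite QE //.
apply: leq_trans (size_scale_leq _ _) _; exact: size_poly.
Qed.

Lemma has_delta_integral_rhoQ (y : seq R) z g : size y = k -> path <%R 1 y -> 1 < z ->
  exists2 v, has_delta_integral k.+1 (z * \prod_(j < k) y`_j) (interlacing k.+1 y)
      (fun x => (Delta_weight n.+1 k.+1 x)%:C%C * sym_eval x (rho k.+1 g)) v &
    symz_eval y z (rhoQ g) = (Ak_coef n.+1 k.+1 z y)%:C%C * v.
Proof.
move=> size_y py z_gt1.
elim/nschur_ind: g => [|f g [vf If Ef] [vg Ig Eg]|a g [v Ig Eg]|lam lamP].
- exists 0; last by rewrite rhoQ0 /symz_eval map_poly0 horner0 mulr0.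
  apply: eq_has_delta_integral (has_delta_integral0 _ _ _) => x.
  by rewrite rho0 // sym_eval0 mulr0.
- exists (vf + vg); last by rewrite (rhoQD f g) symz_evalD mulrDr -Ef -Eg.
  apply: eq_has_delta_integral (has_delta_integralD If Ig) => x.
  by rewrite rhoD // sym_evalD mulrDr.
- exists (a * v); last by rewrite rhoQZ symz_evalZ Eg mulrCA.
  apply: eq_has_delta_integral (has_delta_integralZ a Ig) => x.
  by rewrite rhoZ // sym_evalZ mulrCA.
rewrite symz_eval_nschur //.
exact: has_delta_integral_nschur.
Qed.

(** The integral depends on [g] only through [rho k.+1 g], so [rhoQ g] vanishes for all [z > 1] and
    all increasing [y] above 1, which forces a polynomial to be 0. *)
Lemma rhoQ_ker g : rho k.+1 g = 0 -> rhoQ g = 0.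
Proof.
move=> g0; apply/polyP => i; rewrite coef0; apply: sympoly_val_inj.
rewrite sympoly_val0; apply: mpoly_eq0_path => y size_y py.
rewrite -[LHS]/(sym_eval y (rhoQ g)`_i).
have : map_poly (sym_eval y) (rhoQ g) = 0.
  apply: poly_eq0_gt1 => z z_gt1.
  have [v /has_delta_integralE vE eq_v] := has_delta_integral_rhoQ g size_y py z_gt1.
  rewrite -[LHS]/(symz_eval y z (rhoQ g)) eq_v -vE.
  rewrite g0 (has_delta_integralE (v := 0)) ?mulr0 //.
  apply: eq_has_delta_integral (has_delta_integral0 _ _ _) => x.
  by rewrite sym_eval0 mulr0.
move/(congr1 (fun p : {poly C} => p`_i)).
by rewrite coef0 coef_map_id0 ?sym_eval0.
Qed.

Lemma eq_rhoQ f g : rho k.+1 f = rho k.+1 g -> rhoQ f = rhoQ g.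
Proof.
move=> eq_fg; apply/eqP; rewrite -subr_eq0 -scaleN1r; apply/eqP.
have -> : rhoQ f + -1 *: rhoQ g = rhoQ (f + -1 *: g).
  by rewrite rhoQD rhoQZ !scaleN1r.
apply: rhoQ_ker.
rewrite (rhoD _ _ le_k1n1) (rhoZ _ _ le_k1n1) [X in X + _]eq_fg scaleN1r.
exact: subrr.
Qed.

(** The operator is [rhoQ] after an arbitrary section [L] of [rho k.+1]. The section need not be
    linear: [eq_rhoQ] makes its choice irrelevant. *)
Lemma exists_Ak : exists A : zoperator C k.+1 k,
  forall g, rhoQ g = A (rho k.+1 g).
Proof.
have /choice[L LE] (f : sympoly C k.+1) : exists g : sympoly C n.+1, rho k.+1 g = f :=
  rho_surj f le_k1n1.
have A_lin : linear_for (in_alg (sympoly C k) \; *:%R) (fun f => rhoQ (L f)).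
  move=> a f g /=; rewrite -rhoQZ -rhoQD; apply: eq_rhoQ.
  by rewrite (rhoD _ _ le_k1n1) (rhoZ _ _ le_k1n1) !LE.
pose A : zoperator C k.+1 k :=
  HB.pack (fun f => rhoQ (L f)) (GRing.isLinear.Build _ _ _ _ (fun f => rhoQ (L f)) A_lin).
by exists A => g; apply: eq_rhoQ; rewrite LE.
Qed.

End FactorOperator.

Theorem theorem4p2 (R : realType) (n : nat) (n_gt0 : (0 < n)%N)
    (Q : zoperator R[i] n n) (QE : is_Qz Q) :
  (forall lam : n.-tuple nat, is_partition lam ->
     separating Q (nschur R[i] lam) =
       \prod_(j < n)
         zsubst j (map_poly (in_alg (sympoly R[i] 0)) (q_lambda R[i] lam)))
  /\
  forall k : nat, (0 < k <= n)%N ->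
  exists A : zoperator R[i] k k.-1,
    [/\ forall f : sympoly R[i] n, map_poly (rho k.-1) (Q f) = A (rho k f),
        forall B : zoperator R[i] k k.-1,
          (forall f : sympoly R[i] n,
             map_poly (rho k.-1) (Q f) = B (rho k f)) ->
          B =1 A
      & forall (z : R) (y : k.-1.-tuple R) (f : sympoly R[i] k),
          1 < z -> path <%R 1 y ->
          symz_eval y z (A f) =
            ((-1) ^+ k.-1 * (n.-1)`!%:R
             / ((n - k)`!%:R * (z - 1) ^+ n.-1
                * Delta (fun j : 'I_k.-1 => y`_j)
                * \prod_(j < k.-1) (y`_j - 1) ^+ (n - k + 1)))%:C%C
            * delta_integral k (z * \prod_(j < k.-1) y`_j)
                (interlacing k y)
                (fun x => (Delta (fun j : 'I_k => x`_j)
                           * \prod_(j < k) (x`_j - 1) ^+ (n - k))%:C%C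
                          * sym_eval x f)].
Proof.
split; first by move=> lam; apply: separating_nschur.
case: n n_gt0 Q QE => // n' _ Q' QE' [|k] //= lt_kn.
have [A AE] := exists_Ak QE' lt_kn.
exists A; split => [f|B BE f|z y f z_gt1 py]; first exact: AE.
  (* Uniqueness: every [f] is a specialization, on which the intertwining relation prescribes the
     value. *)
  have [g <-] := rho_surj f lt_kn.
  by rewrite -BE -[LHS]/(rhoQ Q' k g) AE.
have [g <-] := rho_surj f lt_kn.
rewrite -AE.
have [v /has_delta_integralE <- ->] :=
  has_delta_integral_rhoQ QE' lt_kn g (size_tuple y) py z_gt1.
by [].
Qed.
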